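(* Let $(\bar\lambda,\bar b,\bar A)\in\mathbb{R}_+\times\mathbb{R}^m\times\mathbb{R}^{m\times n}$ with $\bar\lambda>0$. The following are equivalent: (i) (Condition 1.2 at $(\bar\lambda,\bar b,\bar A)$) there is some $x\in S(\bar\lambda,\bar b,\bar A)$ such that the columns $\bar A_i$ of $\bar A$ with $i\in I$ satisfying $|\bar A_i^\top(\bar b-\bar Ax)|=\bar\lambda$ are linearly independent; (ii) $S$ is Lipschitz continuous around $(\bar\lambda,\bar b,\bar A)$; (iii) $S(\bar\lambda,\bar b,\cdot)$ is Lipschitz continuous around $\bar A$; (iv) $S(\cdot,\cdot,\bar A)$ is single-valued and linear on each polyhedral cone $P_{1,2}(\mathbb{G}(\bar A,(I^+,I^0,I^-)))$ containing $(\bar\lambda,\bar b)$, where $(I^+,I^0,I^-)\in\mathcal{J}(\bar A)$.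
   Context: Notation: $\mathbb{R}_+=[0,\infty)$; $\|\cdot\|$ is the Euclidean norm (spectral norm for matrices), $\|\cdot\|_1$ the $\ell_1$-norm; $A_i$ is the $i$th column of $A$; $\operatorname{rge}A$ is the range of $A$ and $\operatorname{proj}_{\operatorname{rge}A}b$ the Euclidean projection of $b$ onto it; $\mathbb{B}$ is the closed unit Euclidean ball. Solution multifunction $S:\mathbb{R}\times\mathbb{R}^m\times\mathbb{R}^{m\times n}\rightrightarrows\mathbb{R}^n$: if $\lambda>0$, $S(\lambda,b,A)$ is the set of minimizers over $x\in\mathbb{R}^n$ of $\frac{1}{2\lambda}\|Ax-\operatorname{proj}_{\operatorname{rge}A}b\|^2+\|x\|_1$ (equivalently of $\frac12\|Ax-b\|^2+\lambda\|x\|_1$); if $\lambda=0$, $S(0,b,A)$ is the set of minimizers of $\|x\|_1$ subject to $Ax=\operatorname{proj}_{\operatorname{rge}A}b$; if $\lambda<0$, $S(\lambda,b,A)=\emptyset$. Index partitions: $I=\{1,\dots,n\}$ and $\mathcal{I}$ is the set of all triples $(I^+,I^0,I^-)$ of pairwise disjoint (possibly empty) subsets of $I$ whose union is $I$. $\mathcal{J}(A)$ is the set of $(I^+,I^0,I^-)\in\mathcal{I}$ for which there is $y\in\mathbb{R}^m$ with $A_i^\top y=1$ for $i\in I^+$, $|A_i^\top y|<1$ for $i\in I^0$, $A_i^\top y=-1$ for $i\in I^-$. For $(I^+,I^0,I^-)\in\mathcal{I}$, $\mathbb{G}(A,(I^+,I^0,I^-))$ is the polyhedral cone of all $(\lambda,b,x)\in\mathbb{R}_+\times\mathbb{R}^m\times\mathbb{R}^n$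 such that $x_i\ge0,\ A_i^\top(b-Ax)=\lambda$ for $i\in I^+$; $x_i=0,\ |A_i^\top(b-Ax)|\le\lambda$ for $i\in I^0$; $x_i\le0,\ A_i^\top(b-Ax)=-\lambda$ for $i\in I^-$. $P_{1,2}$ is the projection $(\lambda,b,x)\mapsto(\lambda,b)$. A multifunction $G$ is Lipschitz continuous on a set $X$ if $G(x)$ is nonempty and closed for every $x\in X$ and there is $\kappa\ge0$ with $G(x')\subset G(x)+\kappa\|x'-x\|\mathbb{B}$ for all $x,x'\in X$; it is Lipschitz continuous around a point $\bar x$ of its domain if it is Lipschitz continuous on some neighborhood of $\bar x$. A single-valued mapping is linear on a set $D$ if it coincides on $D$ with a linear map (of the form $z\mapsto Bz$ for a matrix $B$). *)

(* Defs.v *)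
From HB Require Import structures.
From mathcomp Require Import all_boot all_order all_algebra.
From mathcomp Require Import all_classical all_reals all_analysis.

Set Implicit Arguments.
Unset Strict Implicit.
Unset Printing Implicit Defensive.

Import Order.TTheory GRing.Theory Num.Theory.
Import numFieldNormedType.Exports.

Local Open Scope classical_set_scope.
Local Open Scope ring_scope.

(* The library norm on matrices is the sup norm, so the Euclidean and spectral
   norms are defined here.  They induce the library topology, which is the one
   used below for neighborhoods and closed sets. *)
Definition dotv (R : realType) (k : nat) (u v : 'cV[R]_k) : R :=
  (u^T *m v) 0 0.

Definition enorm (R : realType) (k : nat) (u : 'cV[R]_k) : R :=
  Num.sqrt (dotv u u).

Definition l1norm (R : realType) (k : nat) (u : 'cV[R]_k) : R :=
  \sum_(i < k) `|u i 0|.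

Definition unit_ball (R : realType) (k : nat) : set 'cV[R]_k :=
  [set v | enorm v <= 1].

Definition specnorm (R : realType) (m n : nat) (A : 'M[R]_(m, n)) : R :=
  sup [set enorm (A *m v) | v in @unit_ball R n].

Definition argmin (R : realType) (T : Type) (C : set T) (f : T -> R) : set T :=
  [set x | C x /\ forall y, C y -> f x <= f y].

Definition rge (R : realType) (m n : nat) (A : 'M[R]_(m, n)) : set 'cV[R]_m :=
  range (fun x : 'cV[R]_n => A *m x).

(* Since rge A is a linear subspace, the argmin is a singleton and the default
   value 0 of xget is never used. *)
Definition proj (R : realType) (k : nat) (C : set 'cV[R]_k) (b : 'cV[R]_k) :
    'cV[R]_k :=
  xget 0 (argmin C (fun p => enorm (b - p))).

Definition solS (R : realType) (m n : nat)
    (lam : R) (b : 'cV[R]_m) (A : 'M[R]_(m, n)) : set 'cV[R]_n :=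
  if 0 < lam then
    argmin setT (fun x =>
      (2 * lam)^-1 * enorm (A *m x - proj (rge A) b) ^+ 2 + l1norm x)
  else if lam == 0 then
    argmin [set x | A *m x = proj (rge A) b] (@l1norm R n)
  else set0.

(* [free] applies to the family of selected columns: repeated columns make it
   dependent. *)
Definition condition12 (R : realType) (m n : nat)
    (lam : R) (b : 'cV[R]_m) (A : 'M[R]_(m, n)) : Prop :=
  exists2 x, solS lam b A x &
    free [seq col i A | i <- enum 'I_n & `|dotv (col i A) (b - A *m x)| == lam].

(* Lipschitz continuity with respect to the distance [d] on the source. *)
Definition lipschitz_mf_on (R : realType) (T : Type) (d : T -> T -> R)
    (n : nat) (G : T -> set 'cV[R]_n) (X : set T) : Prop :=
  (forall z, X z -> G z !=set0 /\ closed (G z)) /\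
  exists2 kappa : R, 0 <= kappa &
    forall z z', X z -> X z' ->
      G z' `<=`
        [set u + (kappa * d z' z) *: v | u in G z & v in @unit_ball R n].

Definition lipschitz_mf_around (R : realType) (T : topologicalType)
    (d : T -> T -> R) (n : nat) (G : T -> set 'cV[R]_n) (z : T) : Prop :=
  exists2 X : set T, nbhs z X & lipschitz_mf_on d G X.

Definition dist_mx (R : realType) (m n : nat) (A A' : 'M[R]_(m, n)) : R :=
  specnorm (A - A').

Definition dist_data (R : realType) (m n : nat)
    (z z' : R * 'cV[R]_m * 'M[R]_(m, n)) : R :=
  Num.sqrt ((z.1.1 - z'.1.1) ^+ 2 + enorm (z.1.2 - z'.1.2) ^+ 2
            + dist_mx z.2 z'.2 ^+ 2).

(* Blocks may be empty, unlike in finset's [partition]. *)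
Definition index_partition (n : nat) (Ip I0 Im : {set 'I_n}) : Prop :=
  [/\ Ip :&: I0 = finset.set0, Ip :&: Im = finset.set0,
      I0 :&: Im = finset.set0 & Ip :|: I0 :|: Im = finset.setTfor 'I_n].

Definition setJ (R : realType) (m n : nat) (A : 'M[R]_(m, n))
    (Ip I0 Im : {set 'I_n}) : Prop :=
  index_partition Ip I0 Im /\
  exists y : 'cV[R]_m,
    [/\ forall i, i \in Ip -> dotv (col i A) y = 1,
        forall i, i \in I0 -> `|dotv (col i A) y| < 1
      & forall i, i \in Im -> dotv (col i A) y = -1].

Definition coneG (R : realType) (m n : nat) (A : 'M[R]_(m, n))
    (Ip I0 Im : {set 'I_n}) : set (R * 'cV[R]_m * 'cV[R]_n) :=
  [set w | let: (lam, b, x) := w in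
    let corr i := dotv (col i A) (b - A *m x) in
    [/\ 0 <= lam,
        forall i, i \in Ip -> 0 <= x i 0 /\ corr i = lam,
        forall i, i \in I0 -> x i 0 = 0 /\ `|corr i| <= lam
      & forall i, i \in Im -> x i 0 <= 0 /\ corr i = - lam]].

Definition P12 (R : realType) (m n : nat)
    (W : set (R * 'cV[R]_m * 'cV[R]_n)) : set (R * 'cV[R]_m) :=
  fst @` W.

(* The linear map acts on the stacked column vector (lam; b). *)
Definition single_valued_linear_on (R : realType) (m n : nat)
    (G : R * 'cV[R]_m -> set 'cV[R]_n) (D : set (R * 'cV[R]_m)) : Prop :=
  exists B : 'M[R]_(n, 1 + m),
    forall z, D z -> G z = [set B *m col_mx z.1%:M z.2].

(* Main.v *)
Require Import Defs.
From HB Require Import structures.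
From mathcomp Require Import all_boot all_order all_algebra.
From mathcomp Require Import all_classical all_reals all_analysis.
From mathcomp Require Import ring lra.

Set Implicit Arguments.
Unset Strict Implicit.
Unset Printing Implicit Defensive.

Import Order.TTheory GRing.Theory Num.Theory.
Import numFieldNormedType.Exports.

Local Open Scope classical_set_scope.
Local Open Scope ring_scope.

(** For lam > 0 put cert x = lam^-1 A^T (b - A x).  Everything rests on the
optimality condition [solSP]: x solves the problem iff cert x is a subgradient
of the l1 norm at x, that is |cert x i| <= 1 and cert x i * x i = |x i| for
all i.  Monotonicity of the subdifferential gives [fitted_distance], which
bounds |A (x - x')|^2 by the variation of cert between two data at the fixed
point x'; in particular A x, hence cert x and the set K of indices with
|cert x i| = 1, are the same for all solutions of one problem.  Condition (i)
says that A is injective on vectors supported in K.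

(i) implies (ii).  Since cert varies continuously and |cert i| < 1 off K is an
open condition, all solutions for data near the given ones are supported in K.
There |d| is controlled by |A d|, uniformly in A, so that [fitted_distance]
bounds |x - x'| by a multiple of the distance of the data
([condition12_local_stability]).  Existence of solutions is by compactness.

(ii) implies (iii) by freezing lam and b.

(iii) implies (i), the main point.  Assume a vector d <> 0 supported in K with
A d = 0.  The solution set may nevertheless be a single point, so the failure
of Lipschitz continuity is seen only at other matrices.  Close to A there are
matrices A', rank-one corrections of A up to a scalar, that still satisfy
A' d = 0 and for which some solution x' has full support K
([dependent_equicorrelation_tilt]).  Then x' can be moved along d until a
coordinate j vanishes, and this remains a solution for A'.  Shrinking column j
of A' a little forces coordinate j of every solution to be 0, whereas
x' j <> 0: the solution set jumps at A', which lies in the neighborhood where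
it was supposed to be Lipschitz ([not_lipschitz_at_face]).

(i) implies (iv).  On the cone of a partition, a solution is determined by its
support and signs through linear normal equations, and these have a unique
solution because the support lies in K.  Uniqueness of the solution, also at
lam = 0, comes from the vector y that certifies membership in J(A)
([min_l1_unique]).

(iv) implies (i).  For the partition read off a solution at (lam, b), a vector
d as above would make s + t d, with s the sign vector of K and t small, a
solution for the same data as s, against single-valuedness. *)

(** * Inner product, projection on the range *)
Section InnerProduct.
Variable R : realType.

Lemma dotvE k (u v : 'cV[R]_k) : dotv u v = \sum_i u i 0 * v i 0.
Proof. by rewrite /dotv mxE; apply: eq_bigr => i _; rewrite mxE. Qed.

Lemma dotvC k (u v : 'cV[R]_k) : dotv u v = dotv v u.
Proof. by rewrite !dotvE; apply: eq_bigr => i _; rewrite mulrC. Qed.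

Lemma dotvDr k (u v w : 'cV[R]_k) : dotv u (v + w) = dotv u v + dotv u w.
Proof. by rewrite /dotv mulmxDr mxE. Qed.

Lemma dotvZr k a (u v : 'cV[R]_k) : dotv u (a *: v) = a * dotv u v.
Proof. by rewrite /dotv -scalemxAr mxE. Qed.

Lemma dotvNr k (u v : 'cV[R]_k) : dotv u (- v) = - dotv u v.
Proof. by rewrite /dotv mulmxN mxE. Qed.

Lemma dotvDl k (u v w : 'cV[R]_k) : dotv (v + w) u = dotv v u + dotv w u.
Proof. by rewrite !(dotvC _ u) dotvDr. Qed.

Lemma dotvZl k a (u v : 'cV[R]_k) : dotv (a *: v) u = a * dotv v u.
Proof. by rewrite !(dotvC _ u) dotvZr. Qed.

Lemma dotvNl k (u v : 'cV[R]_k) : dotv (- v) u = - dotv v u.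
Proof. by rewrite !(dotvC _ u) dotvNr. Qed.

Definition dotv_lin := (dotvDl, dotvDr, dotvNl, dotvNr, dotvZl, dotvZr).

Lemma dotv0 k (u : 'cV[R]_k) : dotv u 0 = 0.
Proof. by rewrite /dotv mulmx0 mxE. Qed.

Lemma dot0v k (u : 'cV[R]_k) : dotv 0 u = 0.
Proof. by rewrite dotvC dotv0. Qed.

Lemma dotv_trl m n (A : 'M[R]_(m, n)) u v :
  dotv (A^T *m u) v = dotv u (A *m v).
Proof. by rewrite /dotv trmx_mul trmxK mulmxA. Qed.

Lemma dotv_col m n (A : 'M[R]_(m, n)) i r :
  dotv (col i A) r = (A^T *m r) i 0.
Proof. by rewrite dotvE mxE; apply: eq_bigr => j _; rewrite !mxE. Qed.

Lemma dotv_ge0 k (u : 'cV[R]_k) : 0 <= dotv u u.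
Proof. by rewrite dotvE sumr_ge0 // => i _; rewrite -expr2 sqr_ge0. Qed.

Lemma dotv_eq0 k (u : 'cV[R]_k) : (dotv u u == 0) = (u == 0).
Proof.
apply/eqP/eqP => [|->]; last exact: dotv0.
rewrite dotvE => /eqP.
rewrite psumr_eq0 => [/allP u0|i _]; last by rewrite -expr2 sqr_ge0.
apply/matrixP => i j; rewrite (ord1 j) mxE.
have /= := u0 i (mem_index_enum i).
by rewrite -expr2 sqrf_eq0 => /eqP.
Qed.

Lemma dotv_gt0 k (u : 'cV[R]_k) : (0 < dotv u u) = (u != 0).
Proof. by rewrite lt0r dotv_eq0 dotv_ge0 andbT. Qed.

Lemma enorm_ge0 k (u : 'cV[R]_k) : 0 <= enorm u.
Proof. exact: sqrtr_ge0. Qed.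

Lemma sqr_enorm k (u : 'cV[R]_k) : enorm u ^+ 2 = dotv u u.
Proof. by rewrite sqr_sqrtr // dotv_ge0. Qed.

Lemma ler_enorm k (u v : 'cV[R]_k) :
  (enorm u <= enorm v) = (dotv u u <= dotv v v).
Proof. by rewrite /enorm ler_sqrt // dotv_ge0. Qed.

Lemma coord_le_enorm k (u : 'cV[R]_k) i : `|u i 0| <= enorm u.
Proof.
rewrite -sqrtr_sqr ler_sqrt ?dotv_ge0 //.
rewrite dotvE (bigD1 i) //= -expr2 lerDl sumr_ge0 // => j _.
by rewrite -expr2 sqr_ge0.
Qed.

Lemma gram_eq0 m n (A : 'M[R]_(m, n)) (x : 'cV[R]_n) :
  A^T *m (A *m x) = 0 -> A *m x = 0.
Proof.
move=> h; apply/eqP; rewrite -dotv_eq0 -dotv_trl h dot0v //.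
Qed.

End InnerProduct.

Section Projection.
Variables (R : realType) (m n : nat).
Implicit Types (A : 'M[R]_(m, n)) (b : 'cV[R]_m).

(** A^T b lies in the range of A^T A because the Gram matrix and A have the same
kernel ([gram_eq0]). *)
Lemma normal_equation_solvable A b :
  exists x : 'cV[R]_n, A^T *m (A *m x) = A^T *m b.
Proof.
have : (b^T *m A <= A^T *m A)%MS.
  rewrite submxE; move: (cokermx _) (mulmx_coker (A^T *m A)) => C GC0.
  have AC0 : A *m C = 0.
    apply/matrixP => i j.
    have : A *m col j C = 0.
      by apply: gram_eq0; rewrite colE !mulmxA GC0 mul0mx.
    by rewrite colE mulmxA -colE => /colP/(_ i); rewrite !mxE.
  by rewrite -mulmxA AC0 mulmx0.
case/submxP => D hD; exists D^T.
by apply: trmx_inj; rewrite mulmxA !trmx_mul !trmxK hD.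
Qed.

(** The residual b - A x is orthogonal to the range, so Pythagoras makes A x the
only minimizer. *)
Lemma projP A b x : A^T *m (A *m x) = A^T *m b -> Defs.proj (rge A) b = A *m x.
Proof.
move=> hx.
have pyth y : dotv (b - A *m y) (b - A *m y) =
    dotv (b - A *m x) (b - A *m x) + dotv (A *m (x - y)) (A *m (x - y)).
  have -> : b - A *m y = (b - A *m x) + A *m (x - y).
    by rewrite mulmxBr addrA subrK.
  have : dotv (b - A *m x) (A *m (x - y)) = 0.
    by rewrite -dotv_trl mulmxBr hx subrr dot0v.
  move: (b - A *m x) (A *m (x - y)) => u v uv0.
  by rewrite !dotv_lin (dotvC v u) uv0 addr0 add0r.
have : argmin (rge A) (fun p => enorm (b - p)) (Defs.proj (rge A) b).
  apply: xgetPex; exists (A *m x); split; first by exists x.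
  by move=> _ [y _ <-]; rewrite ler_enorm (pyth y) lerDl dotv_ge0.
case=> -[y _ <-] /(_ (A *m x)) /(_ (ex_intro2 _ _ x I erefl)).
rewrite ler_enorm (pyth y) gerDl => h.
have /eqP : dotv (A *m (x - y)) (A *m (x - y)) = 0.
  by apply/eqP; rewrite eq_le h dotv_ge0.
by rewrite dotv_eq0 mulmxBr subr_eq0 => /eqP.
Qed.

Lemma tr_mul_proj A b : A^T *m Defs.proj (rge A) b = A^T *m b.
Proof. by have [x hx] := normal_equation_solvable A b; rewrite (projP hx). Qed.

End Projection.

(** * Optimality conditions *)
Section Optimality.
Variables (R : realType) (m n : nat).
Implicit Types (lam : R) (A : 'M[R]_(m, n)) (b : 'cV[R]_m) (x h : 'cV[R]_n).

(** The candidate subgradient of the l1 norm.  Normalizing by lam makes optimality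
for different values of lam comparable. *)
Definition cert lam b A x : 'cV[R]_n := lam^-1 *: (A^T *m (b - A *m x)).

Definition kkt lam b A x := forall i,
  `|cert lam b A x i 0| <= 1 /\ cert lam b A x i 0 * x i 0 = `|x i 0|.

Lemma dotv_cert lam b A x h :
  dotv (cert lam b A x) h = lam^-1 * dotv (b - A *m x) (A *m h).
Proof. by rewrite dotvZl dotv_trl. Qed.

Lemma cert_increment lam b A x x' :
  cert lam b A x = cert lam b A x' - lam^-1 *: (A^T *m (A *m (x - x'))).
Proof.
rewrite /cert -scalerBr -mulmxBr; congr (_ *: (_ *m _)).
by rewrite mulmxBr opprB addrC addrA addrNK addrC.
Qed.

(** Only A^T proj b = A^T b enters, so the increment is the same as for the
problem with b in place of its projection. *)
Lemma objective_increment lam b A x h : 0 < lam ->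
  let f := fun x => (2 * lam)^-1 * enorm (A *m x - Defs.proj (rge A) b) ^+ 2
                    + l1norm x in
  f (x + h) - f x =
    (2 * lam)^-1 * dotv (A *m h) (A *m h) - dotv (cert lam b A x) h
    + (l1norm (x + h) - l1norm x).
Proof.
move=> lam0 /=; rewrite !sqr_enorm; set p := Defs.proj _ _.
have -> : A *m (x + h) - p = (A *m x - p) + A *m h.
  by rewrite mulmxDr addrAC.
have -> : dotv (cert lam b A x) h = - (lam^-1 * dotv (A *m x - p) (A *m h)).
  rewrite dotv_cert -!dotv_trl !mulmxBr tr_mul_proj.
  by rewrite -[X in dotv X h]opprB dotvNl mulrN.
move: (A *m x - p) (A *m h) => u v.
rewrite !dotv_lin (dotvC v u) invfM; field; lra.
Qed.

(** The quadratic term is negligible for small t, so g is a subgradient of the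
absolute value at x: small t of both signs give |g| <= 1, and t = - e x with e
small gives g x >= |x|. *)
Lemma abs_slope (a g x : R) : 0 <= a ->
  (forall t, 0 <= a * t ^+ 2 - g * t + (`|x + t| - `|x|)) ->
  `|g| <= 1 /\ g * x = `|x|.
Proof.
move=> a0 H.
have H1 t : g * t <= a * t ^+ 2 + `|t|.
  have := H t; have := ler_normD x t; lra.
have g1 : `|g| <= 1.
  apply/ler_addgt0Pr => e e0.
  pose t := e / (a + 1).
  have a1 : 0 < a + 1 by lra.
  have t0 : 0 < t by rewrite divr_gt0.
  have te : a * t <= e.
    rewrite /t mulrCA ger_pMr // ler_pdivrMr //; lra.
  have := H1 t; have := H1 (- t).
  rewrite normrN gtr0_norm // sqrrN !expr2 => h1 h2.
  rewrite ler_norml; apply/andP; split.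
    rewrite -(ler_pM2r t0); nra.
  rewrite -(ler_pM2r t0); nra.
split => //.
have gx : g * x <= `|x|.
  apply: (le_trans (ler_norm _)); rewrite normrM ler_piMl //.
apply/eqP; rewrite eq_le gx /=.
apply/ler_addgt0Pr => e e0.
pose c := a * x ^+ 2; have c0 : 0 <= c by rewrite mulr_ge0 // sqr_ge0.
have c1 : 0 < c + e by lra.
pose t := e / (c + e).
have t0 : 0 < t by rewrite divr_gt0.
have t1 : t <= 1 by rewrite ler_pdivrMr //; lra.
have tc : c * t <= e.
  rewrite /t mulrCA ger_pMr // ler_pdivrMr //; lra.
have := H (- t * x).
have -> : x + - t * x = (1 - t) * x by ring.
rewrite normrM (ger0_norm (_ : 0 <= 1 - t)); last by lra.
have -> : a * (- t * x) ^+ 2 = c * t * t by rewrite /c; ring.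
move=> h; rewrite -(ler_pM2r t0); nra.
Qed.

(** Testing along coordinate directions gives necessity; sufficiency is the
subgradient inequality summed over the coordinates. *)
Lemma solSP lam b A x : 0 < lam -> solS lam b A x <-> kkt lam b A x.
Proof.
move=> lam0; rewrite /solS lam0.
have D h := objective_increment b A x h lam0.
split=> [[_ xmin] i | K].
  apply: (@abs_slope ((2 * lam)^-1 * dotv (col i A) (col i A))) => [|t].
    by rewrite mulr_ge0 ?dotv_ge0 // invr_ge0; lra.
  pose h : 'cV[R]_n := t *: delta_mx i 0.
  have := xmin (x + h) I; rewrite -subr_ge0 D => /le_trans; apply.
  rewrite le_eqVlt; apply/orP; left; apply/eqP; congr (_ - _ + _).
  - by rewrite /h -scalemxAr -colE !dotv_lin; ring.
  - rewrite /h dotvZr mulrC; congr (_ * _).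
    rewrite dotvE (bigD1 i) //= big1 => [|j ji].
      by rewrite !mxE ?eqxx ?mulr1 ?addr0.
    rewrite !mxE.
    by rewrite (negbTE ji) mulr0.
  - rewrite /l1norm -sumrB (bigD1 i) //= big1 => [|j ji].
      by rewrite !mxE !eqxx mulr1 addr0.
    by rewrite !mxE (negbTE ji) mulr0 addr0 subrr.
split=> // y _; rewrite -subr_ge0.
have -> : y = x + (y - x) by rewrite addrC subrK.
rewrite D; set h := y - x.
suff : dotv (cert lam b A x) h <= l1norm (x + h) - l1norm x.
  have : 0 <= (2 * lam)^-1 * dotv (A *m h) (A *m h).
    by rewrite mulr_ge0 ?dotv_ge0 // invr_ge0; lra.
  lra.
rewrite dotvE /l1norm -sumrB ler_sum // => i _.
have [g1 gx] := K i.
have -> : (x + h) i 0 = x i 0 + h i 0 by rewrite mxE.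
rewrite lerBrDr -gx -mulrDr addrC (le_trans (ler_norm _)) //.
by rewrite normrM ler_piMl.
Qed.

Lemma kkt_monotone lam b A x lam' b' A' x' :
  kkt lam b A x -> kkt lam' b' A' x' ->
  0 <= dotv (cert lam b A x - cert lam' b' A' x') (x - x').
Proof.
move=> K K'; rewrite dotvE sumr_ge0 // => i _.
have [g1 gx] := K i; have [g1' gx'] := K' i.
rewrite ![(_ - _ : 'cV[R]_n) i 0]mxE ![(- _ : 'cV[R]_n) i 0]mxE.
move: (cert lam b A x i 0) (cert lam' b' A' x' i 0) g1 gx g1' gx'.
move=> g g' g1 gx g1' gx'.
have a1 : g * x' i 0 <= `|x' i 0|.
  by rewrite (le_trans (ler_norm _)) // normrM ler_piMl.
have a2 : g' * x i 0 <= `|x i 0|.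
  by rewrite (le_trans (ler_norm _)) // normrM ler_piMl.
nra.
Qed.

(** Replacing x by x' inside cert costs exactly - lam^-1 A^T A (x - x'), whose
pairing with x - x' is - lam^-1 |A (x - x')|^2; monotonicity bounds it by the
difference of the two certificates at the same point x'. *)
Lemma fitted_distance lam b A x lam' b' A' x' : 0 < lam ->
  kkt lam b A x -> kkt lam' b' A' x' ->
  dotv (A *m (x - x')) (A *m (x - x')) <=
  lam * dotv (cert lam b A x' - cert lam' b' A' x') (x - x').
Proof.
move=> lam0 K K'; have := kkt_monotone K K'.
have -> : cert lam b A x - cert lam' b' A' x' =
  (cert lam b A x' - cert lam' b' A' x') - lam^-1 *: (A^T *m (A *m (x - x'))).
  by rewrite [cert lam b A x](cert_increment _ _ _ _ x') addrAC.
rewrite dotvDl dotvNl dotvZl dotv_trl => h.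
have := mulr_ge0 (ltW lam0) h.
rewrite mulrDr mulrN mulrA divff ?gt_eqF // mul1r; lra.
Qed.

Lemma fitted_unique lam b A x x' : 0 < lam ->
  kkt lam b A x -> kkt lam b A x' -> A *m x = A *m x'.
Proof.
move=> lam0 K K'; have := fitted_distance lam0 K K'.
rewrite subrr dot0v mulr0 => h.
have : dotv (A *m (x - x')) (A *m (x - x')) == 0.
  by rewrite eq_le h dotv_ge0.
by rewrite dotv_eq0 mulmxBr subr_eq0 => /eqP.
Qed.

(** The l1 norm of a solution depends on A x only (see [dotv_cert]). *)
Lemma kkt_l1norm lam b A x : kkt lam b A x ->
  l1norm x = dotv (cert lam b A x) x.
Proof. by move=> K; rewrite dotvE; apply: eq_bigr => i _; rewrite (K i).2. Qed.

Lemma kkt_sign lam b A x i : kkt lam b A x -> x i 0 != 0 ->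
  `|cert lam b A x i 0| = 1.
Proof.
move=> K xi; have [_ gx] := K i; apply: (mulIf (_ : `|x i 0| != 0)).
  by rewrite normr_eq0.
by rewrite mul1r -normrM gx normr_id.
Qed.

Lemma kkt_zero lam b A x i : kkt lam b A x -> `|cert lam b A x i 0| < 1 ->
  x i 0 = 0.
Proof.
move=> K lt1; apply/eqP; apply: contraTT lt1 => /(kkt_sign K) ->.
by rewrite ltxx.
Qed.

End Optimality.

(** * Entrywise limits and existence of solutions *)
Section MatrixLimits.
Variables (R : realType) (T : Type) (F : set_system T).
Hypothesis FF : Filter F.

Lemma cvg_mxP m n (f : T -> 'M[R]_(m, n)) (l : 'M[R]_(m, n)) :
  f x @[x --> F] --> l <-> forall i j, f x i j @[x --> F] --> l i j.
Proof.
split=> [fl i j|fl].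
  exact: (cvg_comp _ _ fl (@coord_continuous R m n i j l)).
apply/cvgrPdist_lt => e e0.
have : \forall x \near F, forall ij : 'I_m * 'I_n,
    `|l ij.1 ij.2 - f x ij.1 ij.2| < e.
  by apply: filter_forall => -[i j]; move/cvgrPdist_lt: (fl i j); exact.
apply: filterS => x h; rewrite [ltLHS]/Num.Def.normr /= mx_normrE.
by apply/bigmax_ltP; split=> // -[i j] _; rewrite !mxE; exact: (h (i, j)).
Qed.

Lemma cvg_sumr (I : finType) (f : I -> T -> R) (l : I -> R) :
  (forall i, f i x @[x --> F] --> l i) ->
  \sum_i f i x @[x --> F] --> \sum_i l i.
Proof.
by move=> fl; apply: cvg_big => [|i _]; [exact: add_continuous|exact: fl].
Qed.

Lemma cvg_mulmx m n p (f : T -> 'M[R]_(m, n)) (g : T -> 'M[R]_(n, p))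
    (A : 'M[R]_(m, n)) (B : 'M[R]_(n, p)) :
  f x @[x --> F] --> A -> g x @[x --> F] --> B ->
  f x *m g x @[x --> F] --> A *m B.
Proof.
move=> /cvg_mxP fA /cvg_mxP gB; apply/cvg_mxP => i j; rewrite !mxE.
under eq_cvg do rewrite mxE.
by apply: cvg_sumr => k; apply: cvgM.
Qed.

Lemma cvg_trmx m n (f : T -> 'M[R]_(m, n)) (A : 'M[R]_(m, n)) :
  f x @[x --> F] --> A -> (f x)^T @[x --> F] --> A^T.
Proof.
move=> /cvg_mxP fA; apply/cvg_mxP => i j; rewrite !mxE.
under eq_cvg do rewrite mxE.
exact: fA.
Qed.

Lemma cvg_dotv n (f g : T -> 'cV[R]_n) (u v : 'cV[R]_n) :
  f x @[x --> F] --> u -> g x @[x --> F] --> v ->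
  dotv (f x) (g x) @[x --> F] --> dotv u v.
Proof.
move=> fu gv; rewrite /dotv.
have /cvg_mxP := cvg_mulmx (cvg_trmx fu) gv; exact.
Qed.

Lemma cvg_l1norm n (f : T -> 'cV[R]_n) (u : 'cV[R]_n) :
  f x @[x --> F] --> u -> l1norm (f x) @[x --> F] --> l1norm u.
Proof. by move=> /cvg_mxP fu; apply: cvg_sumr => i; apply: cvg_norm. Qed.

Lemma cvg_objective m n c (A : 'M[R]_(m, n)) p
    (f : T -> 'cV[R]_n) (u : 'cV[R]_n) :
  f x @[x --> F] --> u ->
  c * enorm (A *m f x - p) ^+ 2 + l1norm (f x) @[x --> F] -->
  c * enorm (A *m u - p) ^+ 2 + l1norm u.
Proof.
move=> fu; apply: cvgD; last exact: cvg_l1norm.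
rewrite sqr_enorm; under eq_cvg do rewrite sqr_enorm.
have resid : A *m f x - p @[x --> F] --> A *m u - p.
  by apply: cvgB; [apply: cvg_mulmx; [exact: cvg_cst|] | exact: cvg_cst].
by apply: cvgM; [exact: cvg_cst | exact: cvg_dotv].
Qed.

End MatrixLimits.

Section Existence.
Variables (R : realType) (m n : nat).

(** The objective dominates every |x i|, so a minimizer on the box of radius
f 0 is a global minimizer. *)
Lemma kkt_exists (lam : R) (b : 'cV[R]_m) (A : 'M[R]_(m, n)) : 0 < lam ->
  exists x, kkt lam b A x.
Proof.
move=> lam0.
pose p := Defs.proj (rge A) b.
pose f (x : 'cV[R]_n) := (2 * lam)^-1 * enorm (A *m x - p) ^+ 2 + l1norm x.
pose c := f 0.
pose C := [set v : 'rV[R]_n | forall i, `[- c, c]%classic (v ord0 i)].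
have c2 : 0 <= (2 * lam)^-1 by rewrite invr_ge0; lra.
have fge (x : 'cV[R]_n) i : `|x i 0| <= f x.
  rewrite /f /l1norm (bigD1 i) //= addrCA lerDl.
  by rewrite addr_ge0 ?sumr_ge0 // mulr_ge0 ?sqr_ge0.
have c0 : 0 <= c by rewrite /c /f addr_ge0 ?sumr_ge0 // mulr_ge0 ?sqr_ge0.
have C0 : C 0 by move=> i; rewrite /= in_itv /= mxE oppr_le0 c0.
have Cc : compact C.
  apply: (@rV_compact _ _ (fun=> `[- c, c]%classic)) => _.
  exact: segment_compact.
have fc : continuous (fun v : 'rV[R]_n => f v^T).
  move=> v.
  have h : (fun u : 'rV[R]_n => u) @ nbhs v --> v by exact: cvg_id.
  exact: (cvg_objective (nbhs_filter v) (cvg_trmx (nbhs_filter v) h)).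
have [v _ vmin] := EVT_min_rV (ex_intro _ _ C0) Cc
  (continuous_subspaceT fc).
exists v^T; apply/(solSP _ _ _ lam0); rewrite /solS lam0; split=> // y _.
rewrite -/p -!/(f _).
have fv0 : f v^T <= c by rewrite /c -(trmx0 _ 1 n); apply: vmin; rewrite inE.
have [yC|] := pselect (C y^T).
  by rewrite -[y]trmxK; apply: vmin; rewrite inE.
move=> /existsNP[i] /= h.
apply: (le_trans fv0); apply: le_trans (fge y i).
rewrite leNgt; apply/negP => /ltW; rewrite ler_norml => h'.
by apply: h; rewrite in_itv /= mxE.
Qed.

End Existence.

(** * Independence of columns as injectivity on a support *)
Section Independence.
Variables (R : realType) (m n : nat).

Definition injective_on_support (A : 'M[R]_(m, n)) (P : pred 'I_n) :=
  forall d : 'cV[R]_n, (forall i, ~~ P i -> d i 0 = 0) -> A *m d = 0 -> d = 0.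

(** Coefficient families indexed by the positions in the selected sequence of
columns correspond to vectors that vanish off P. *)
Lemma free_columnsP (A : 'M[R]_(m, n)) (P : pred 'I_n) :
  free [seq col i A | i <- enum 'I_n & P i] <-> injective_on_support A P.
Proof.
set e := [seq i <- _ | _]; set X := map _ _.
have ue : uniq e by rewrite filter_uniq // enum_uniq.
have memE i : (i \in e) = P i by rewrite mem_filter mem_enum andbT.
have sX : size X = size e by rewrite size_map.
have combE (d : 'cV[R]_n) : (forall i, ~~ P i -> d i 0 = 0) ->
    A *m d = \sum_(i <- e) d i 0 *: col i A.
  move=> dP; rewrite big_filter big_enum_cond /=.
  apply/colP => k; rewrite mxE summxE.
  rewrite (bigID P) /= [X in _ + X]big1 ?addr0 => [|i /dP->]; last first.
    by rewrite mulr0.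
  by apply: eq_bigr => i _; rewrite !mxE mulrC.
have idxE (F : 'I_n -> 'cV[R]_m) (i0 : 'I_n) :
    \sum_(i <- e) F i = \sum_(k < size X) F (nth i0 e k).
  by rewrite (big_nth i0) big_mkord sX.
split=> [/(@freeP _ _ _ (in_tuple X)) fr d dP Ad0 | inj].
  apply/colP => i; rewrite mxE.
  have [Pi|/dP//] := boolP (P i).
  have := fr (fun k => d (nth i e k) 0).
  have -> : \sum_(k < size X) d (nth i e k) 0 *: (in_tuple X)`_k = A *m d.
    rewrite (combE _ dP) (idxE _ i); apply: eq_bigr => k _ /=.
    by rewrite (nth_map i) // -sX.
  move=> /(_ Ad0).
  have ilt : (index i e < size X)%N by rewrite sX index_mem memE.
  by move=> /(_ (Ordinal ilt)) /=; rewrite nth_index // memE.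
apply/(@freeP _ _ _ (in_tuple X)) => k kX j.
have ex_i : {i : 'I_n | nth i e j = i}.
  have : (j < size e)%N by rewrite -sX.
  case: (e) => // i0 e' je; exists (nth i0 (i0 :: e') j).
  exact: set_nth_default.
have [i0 _] := ex_i.
pose d : 'cV[R]_n := \col_i (if insub (index i e) is Some l then k l else 0).
have d0 : d = 0.
  apply: inj => [i|].
    by rewrite -memE -index_mem -sX mxE => h; rewrite insubN.
  rewrite combE => [|i]; last first.
    by rewrite -memE -index_mem -sX mxE => h; rewrite insubN.
  rewrite (idxE _ i0) -[RHS]kX; apply: eq_bigr => l _ /=.
  have ls : (l < size e)%N by rewrite -sX.
  rewrite (nth_map i0) //; congr (_ *: _).
  by rewrite mxE index_uniq // valK.
have js : (j < size e)%N by rewrite -sX.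
have := congr1 (fun M : 'cV[R]_n => M (nth i0 e j) 0) d0.
by rewrite !mxE index_uniq // valK.
Qed.

Lemma not_injective_on_support (A : 'M[R]_(m, n)) (P : pred 'I_n) :
  ~ injective_on_support A P ->
  exists d : 'cV[R]_n,
    [/\ forall i, ~~ P i -> d i 0 = 0, A *m d = 0 & d != 0].
Proof.
move=> /existsNP[d] /not_implyP[dP] /not_implyP[Ad] /eqP d0.
by exists d.
Qed.

End Independence.

Section Condition.
Variables (R : realType) (m n : nat).

Lemma abs_corr (lam : R) (b : 'cV[R]_m) (A : 'M[R]_(m, n)) x i : 0 < lam ->
  (`|dotv (col i A) (b - A *m x)| == lam) = (`|cert lam b A x i 0| == 1).
Proof.
move=> lam0.
rewrite dotv_col [cert _ _ _ _ i 0]mxE normrM gtr0_norm ?invr_gt0 //.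
apply/eqP/eqP => [->|h]; first by rewrite mulVf ?gt_eqF.
by rewrite -[RHS]mulr1 -h mulVKf ?gt_eqF.
Qed.

Lemma condition12P (lam : R) (b : 'cV[R]_m) (A : 'M[R]_(m, n)) : 0 < lam ->
  condition12 lam b A <-> exists2 x, kkt lam b A x &
    injective_on_support A [pred i | `|cert lam b A x i 0| == 1].
Proof.
move=> lam0; split=> -[x xS H]; exists x.
- exact/solSP.
- apply/free_columnsP; move: H; congr (is_true (free _)); congr map.
  by apply: eq_filter => i /=; rewrite abs_corr.
- exact/solSP.
- move/free_columnsP: H; congr (is_true (free _)); congr map.
  by apply: eq_filter => i /=; rewrite abs_corr.
Qed.

End Condition.

(** * Linearity on the cones of a partition *)
Section SupportedSystems.
Variables (R : realType) (m n : nat).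
Implicit Types (A : 'M[R]_(m, n)) (P : pred 'I_n).

Lemma unitmx_cker (M : 'M[R]_n) :
  (forall d : 'cV[R]_n, M *m d = 0 -> d = 0) -> M \in unitmx.
Proof.
move=> H; rewrite -unitmx_tr -row_free_unit -kermx_eq0.
apply/eqP/row_matrixP => i.
rewrite row0; apply: trmx_inj; rewrite trmx0; apply: H; apply: trmx_inj.
by rewrite trmx_mul trmxK -row_mul mulmx_ker row0 trmx0.
Qed.

(** With D the diagonal projection onto the coordinates in P, the square matrix
M = D A^T A + (1 - D) is invertible exactly when A is injective on the support
P, and L = M^-1 D solves the normal equations restricted to P.  Working with M
avoids extracting submatrices. *)
Lemma supported_solve A P : injective_on_support A P ->
  exists L : 'M[R]_n,
    (forall d : 'cV[R]_n, (forall i, ~~ P i -> d i 0 = 0) ->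
       d = L *m (A^T *m (A *m d))) /\
    (forall u v : 'cV[R]_n, (forall i, P i -> u i 0 = v i 0) ->
       L *m u = L *m v).
Proof.
move=> inj.
pose D : 'M[R]_n := diag_mx (\row_i (P i)%:R).
have DE (u : 'cV[R]_n) i : (D *m u) i 0 = (P i)%:R * u i 0.
  by rewrite mul_diag_mx !mxE.
pose M := D *m (A^T *m A) + (1%:M - D).
have ME (d : 'cV[R]_n) : M *m d = D *m (A^T *m (A *m d)) + (d - D *m d).
  by rewrite mulmxDl mulmxBl mul1mx !mulmxA.
have Mu : M \in unitmx.
  apply: unitmx_cker => d; rewrite ME => Md.
  have dP i : ~~ P i -> d i 0 = 0.
    move=> /negbTE Pi; have := congr1 (fun v : 'cV[R]_n => v i 0) Md.
    rewrite !mxE; rewrite -!/((_ *m _) i 0) => <-.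
    have := DE (A^T *m (A *m d)) i; have := DE d i.
    by rewrite Pi !mul0r !mxE => -> ->; rewrite add0r subr0.
  apply: inj => //; apply/eqP; rewrite -dotv_eq0 -dotv_trl dotvC dotvE.
  apply/eqP/big1 => i _.
  have [Pi|/dP->] := boolP (P i); last by rewrite mul0r.
  have := congr1 (fun v : 'cV[R]_n => v i 0) Md.
  have := DE (A^T *m (A *m d)) i; have := DE d i.
  rewrite Pi !mul1r; move: (D *m d) (D *m _) (A^T *m _) => u v w.
  by rewrite !mxE => -> ->; rewrite subrr addr0 => ->; rewrite mulr0.
exists (invmx M *m D); split=> [d dP | u v uv]; rewrite -!mulmxA.
  have -> : D *m (A^T *m (A *m d)) = M *m d.
    rewrite ME (_ : D *m d = d) ?subrr ?addr0 //; apply/colP => i.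
    by rewrite DE; have [_|/dP->] := boolP (P i); rewrite ?mul1r ?mulr0.
  by rewrite mulKmx.
congr (_ *m _); apply/colP => i; rewrite !DE.
by case: (boolP (P i)) => [/uv->|_]; rewrite ?mul0r.
Qed.

End SupportedSystems.

Section Cones.
Variables (R : realType) (m n : nat).
Implicit Types (A : 'M[R]_(m, n)) (b : 'cV[R]_m) (Ip Iz Im : {set 'I_n}).

Lemma index_partitionP Ip Iz Im i : index_partition Ip Iz Im ->
  [\/ i \in Ip, i \in Iz | i \in Im].
Proof.
case=> _ _ _ /setP/(_ i); rewrite !inE => /orP[/orP[]|] h.
- exact: Or31.
- exact: Or32.
- exact: Or33.
Qed.

Lemma coneG_kkt A b lam Ip Iz Im x : 0 < lam -> index_partition Ip Iz Im ->
  coneG A Ip Iz Im (lam, b, x) -> kkt lam b A x.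
Proof.
move=> lam0 part [_ Gp Gz Gm] i.
have gE : cert lam b A x i 0 = lam^-1 * dotv (col i A) (b - A *m x).
  by rewrite dotv_col [LHS]mxE.
have [/Gp[x0 c]|/Gz[-> c]|/Gm[x0 c]] := index_partitionP i part; rewrite gE.
- by rewrite c mulVf ?gt_eqF // normr1 mul1r ger0_norm.
- by rewrite mulr0 normr0 normrM gtr0_norm ?invr_gt0 // ler_pdivrMl // mulr1.
- rewrite c mulrN mulVf ?gt_eqF // normrN normr1 mulN1r ler0_norm //.
Qed.

(** The vector A^T y is a subgradient of the l1 norm at x that is strictly below 1
in absolute value on Iz: the pairing of A^T y with x' depends on A x' only, so
x' can reach the norm of x only if x' is supported off Iz, where A is
injective. *)
Lemma min_l1_unique A Ip Iz Im (x x' : 'cV[R]_n) : setJ A Ip Iz Im ->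
  injective_on_support A [pred i | (i \in Ip) || (i \in Im)] ->
  (forall i, i \in Ip -> 0 <= x i 0) -> (forall i, i \in Iz -> x i 0 = 0) ->
  (forall i, i \in Im -> x i 0 <= 0) -> A *m x' = A *m x ->
  l1norm x <= l1norm x' /\ (l1norm x' <= l1norm x -> x' = x).
Proof.
move=> [part [y [yp y0 ym]]] inj xp x0 xm Ax.
have yE i : dotv (col i A) y = (A^T *m y) i 0 by rewrite dotv_col.
have xE : l1norm x = dotv (A^T *m y) x.
  rewrite dotvE; apply: eq_bigr => i _; rewrite -yE.
  have [ip|i0|im] := index_partitionP i part.
  - by rewrite yp // mul1r ger0_norm ?xp.
  - by rewrite x0 // mulr0 normr0.
  - by rewrite ym // mulN1r ler0_norm ?xm.
have gap : l1norm x' - l1norm x = \sum_i (`|x' i 0| - (A^T *m y) i 0 * x' i 0).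
  by rewrite sumrB xE dotv_trl -Ax -dotv_trl -dotvE.
have gap0 i : 0 <= `|x' i 0| - (A^T *m y) i 0 * x' i 0.
  rewrite subr_ge0 (le_trans (ler_norm _)) // normrM ler_piMl // -yE.
  have [ip|i0|im] := index_partitionP i part.
  - by rewrite yp // normr1.
  - by rewrite ltW // y0.
  - by rewrite ym // normrN normr1.
split=> [|le]; first by rewrite -subr_ge0 gap sumr_ge0.
have {}gap i : `|x' i 0| - (A^T *m y) i 0 * x' i 0 = 0.
  have /eqP : l1norm x' - l1norm x = 0.
    by apply/eqP; rewrite eq_le subr_le0 le gap sumr_ge0.
  rewrite gap psumr_eq0 // => /allP /(_ i (mem_index_enum i)) /=.
  by move=> /eqP.
have x'0 i : i \in Iz -> x' i 0 = 0.
  move=> i0; have := gap i; have := y0 i i0; rewrite yE => lt1 /eqP.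
  rewrite subr_eq0 => /eqP h; apply/eqP; rewrite -normr_eq0.
  have : `|x' i 0| <= `|(A^T *m y) i 0| * `|x' i 0|.
    by rewrite -normrM {1}h ler_norm.
  rewrite eq_le normr_ge0 andbT -subr_ge0 => h2.
  rewrite leNgt; apply/negP => h3; clear -lt1 h2 h3; nra.
apply/eqP; rewrite -subr_eq0; apply/eqP; apply: inj; last first.
  by rewrite mulmxBr Ax subrr.
move=> i /=; rewrite negb_or => /andP[ip im].
have i0 : i \in Iz.
  by have [h|//|h] := index_partitionP i part; [rewrite h in ip|rewrite h in im].
by rewrite !mxE x'0 // x0 // subrr.
Qed.

(** At lam = 0 the cone forces A^T (b - A x) = 0, so that A x is the projection of
b and the problem is l1 minimization on the fibre of A x. *)
Lemma coneG_solS A b lam Ip Iz Im x : setJ A Ip Iz Im ->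
  injective_on_support A [pred i | (i \in Ip) || (i \in Im)] ->
  coneG A Ip Iz Im (lam, b, x) -> solS lam b A = [set x].
Proof.
move=> J inj G; have part := J.1.
have [lam_ge0 Gp Gz Gm] := G.
have min x' := @min_l1_unique A Ip Iz Im x x' J inj (fun i h => (Gp i h).1)
  (fun i h => (Gz i h).1) (fun i h => (Gm i h).1).
have [lam0|lam_gt0] := eqVneq lam 0; last first.
  have lam0 : 0 < lam by rewrite lt0r lam_gt0.
  have K := coneG_kkt lam0 part G.
  apply/seteqP; split=> x' /=; last by move=> ->; exact/solSP.
  move=> /(solSP _ _ _ lam0) K'.
  have Ax := fitted_unique lam0 K' K.
  apply: (min x' Ax).2.
  by rewrite (kkt_l1norm K) (kkt_l1norm K') !dotv_cert Ax.
have pE : Defs.proj (rge A) b = A *m x.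
  apply: projP; apply/eqP; rewrite eq_sym -subr_eq0 -mulmxBr.
  apply/eqP/colP => i.
  rewrite -dotv_col mxE.
  have [/Gp[_ c]|/Gz[_ c]|/Gm[_ c]] := index_partitionP i part.
  - by rewrite c.
  - by apply/eqP; rewrite -normr_le0 -lam0.
  - by rewrite c lam0 oppr0.
rewrite /solS lam0 ltxx eqxx pE; apply/seteqP; split=> x' /=.
  by move=> [Ax le]; apply: (min x' Ax).2; apply: le.
by move=> ->; split=> // x'' /min [].
Qed.

Lemma condition12_linear lam b A : 0 < lam -> condition12 lam b A ->
  forall Ip Iz Im, setJ A Ip Iz Im -> P12 (coneG A Ip Iz Im) (lam, b) ->
  single_valued_linear_on (fun z => solS z.1 z.2 A) (P12 (coneG A Ip Iz Im)).
Proof.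
move=> lam0 /(condition12P _ _ lam0) [x K inj] Ip Iz Im J.
case=> -[[l1 b1] x0] G /= [E1 E2]; subst l1 b1.
have K0 := coneG_kkt lam0 J.1 G.
have injP : injective_on_support A [pred i | (i \in Ip) || (i \in Im)].
  move=> d dP; apply: inj => i /= gi; apply: dP; apply: contraNN gi => /= iP.
  have -> : cert lam b A x = cert lam b A x0.
    by rewrite /cert (fitted_unique lam0 K K0).
  rewrite -abs_corr //; have [_ Gp _ Gm] := G.
  case/orP: iP => [/Gp|/Gm] [_ ->]; first by rewrite gtr0_norm.
  by rewrite normrN gtr0_norm.
have [L [Ld Leq]] := supported_solve injP.
pose s : 'cV[R]_n := \col_i ((i \in Ip)%:R - (i \in Im)%:R).
exists (L *m row_mx (- s) A^T) => -[lam' b'].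
case=> -[[l1 b1] x'] G' /= [E1 E2]; subst l1 b1.
rewrite (coneG_solS J injP G'); congr [set _].
have [_ G'p G'z G'm] := G'.
rewrite -mulmxA mul_row_col mul_mx_scalar (Ld x').
  apply: Leq => i /= iP.
  have -> : A^T *m (A *m x') = A^T *m b' - A^T *m (b' - A *m x').
    by rewrite mulmxBr subKr.
  rewrite mxE [in RHS]mxE addrC; congr (_ + _).
  rewrite ![(- _ : 'cV[R]_n) _ _]mxE ![(_ *: _ : 'cV[R]_n) _ _]mxE.
  rewrite -dotv_col ![(- _ : 'cV[R]_n) _ _]mxE ![s _ _]mxE.
  have [[dpm0 dpm dm0 _] _] := J.
  have pm : ~~ ((i \in Ip) && (i \in Im)).
    by have /setP/(_ i) := dpm; rewrite !inE => ->.
  case/orP: iP pm => iP; rewrite iP ?andbT /= => h.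
    by rewrite (G'p i iP).2 (negbTE h) subr0 mulrN1.
  by rewrite (G'm i iP).2 (negbTE h) sub0r !opprK mulr1.
move=> i /=; rewrite negb_or => /andP[ip im].
have i0 : i \in Iz.
  by have [h|//|h] := index_partitionP i J.1; [rewrite h in ip|rewrite h in im].
by case: (G'z i i0).
Qed.

(** If A d = 0 with d <> 0 supported in K, the data b' = lam y + A s make both s
and s + d' solutions, where s is the sign vector of K and d' is a multiple of d
with entries at most 1, so that signs are preserved. *)
Lemma linear_condition12 lam b A : 0 < lam ->
  (forall Ip Iz Im, setJ A Ip Iz Im -> P12 (coneG A Ip Iz Im) (lam, b) ->
   single_valued_linear_on (fun z => solS z.1 z.2 A) (P12 (coneG A Ip Iz Im))) ->
  condition12 lam b A.
Proof.
move=> lam0 H; have [x K] := kkt_exists b A lam0.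
apply/(condition12P _ _ lam0); exists x => //.
set P := [pred i | _].
pose g := cert lam b A x; pose y := lam^-1 *: (b - A *m x).
have gy i : dotv (col i A) y = g i 0.
  by rewrite dotv_col /g /cert /y -scalemxAr.
pose Ip := [set i | g i 0 == 1]%SET; pose Im := [set i | g i 0 == -1]%SET.
pose Iz := [set i | `|g i 0| < 1]%SET.
have gP i : P i = (i \in Ip) || (i \in Im).
  by rewrite !inE /= eqr_norml ler01 andbT.
have m1 : (-1 : R) != 1 by rewrite lt_eqF //; lra.
have J : setJ A Ip Iz Im.
  split; last first.
    by exists y; split=> i; rewrite inE gy => // /eqP.
  split; apply/setP => i; rewrite !inE.
  - by apply/negP => /andP[/eqP->]; rewrite normr1 ltxx.
  - by apply/negP => /andP[/eqP->]; rewrite eq_sym (negbTE m1).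
  - by apply/negP => /andP[h /eqP E]; rewrite E normrN normr1 ltxx in h.
  - have [+ _] := K i; rewrite -/g le_eqVlt eqr_norml ler01 andbT.
    by case: (g i 0 == 1) => //; case: (g i 0 == -1); rewrite ?orbT //= => ->.
pose s : 'cV[R]_n := \col_i (if P i then g i 0 else 0).
have sp i : i \in Ip -> s i 0 = 1.
  by move=> ip; rewrite mxE gP ip; rewrite inE in ip; apply/eqP.
have sm i : i \in Im -> s i 0 = - 1.
  by move=> im; rewrite mxE gP im orbT; rewrite inE in im; apply/eqP.
have P0 i : i \in Iz -> P i = false.
  by rewrite !inE /= lt_neqAle => /andP[/negbTE].
have lamy i : dotv (col i A) (lam *: y) = lam * g i 0 by rewrite dotvZr gy.
have Gd (b' : 'cV[R]_m) (d : 'cV[R]_n) : b' - A *m (s + d) = lam *: y ->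
    (forall i, ~~ P i -> d i 0 = 0) -> (forall i, `|d i 0| <= 1) ->
    coneG A Ip Iz Im (lam, b', s + d).
  move=> r dP d1; split; first exact: ltW.
  - move=> i ip; rewrite r lamy; move: (ip); rewrite inE => /eqP ->.
    rewrite mulr1 mxE sp //; have := d1 i.
    by rewrite ler_norml => /andP[]; split=> //; lra.
  - move=> i i0; have Pi := P0 i i0; rewrite r lamy; split.
      by rewrite mxE dP ?Pi // addr0 mxE Pi.
    rewrite normrM gtr0_norm // ger_pMr //; rewrite inE in i0; exact: ltW.
  - move=> i im; rewrite r lamy; move: (im); rewrite inE => /eqP ->.
    rewrite mulrN1 mxE sm //; have := d1 i.
    by rewrite ler_norml => /andP[]; split=> //; lra.
have xG : coneG A Ip Iz Im (lam, b, x).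
  have bx i : dotv (col i A) (b - A *m x) = lam * g i 0.
    by rewrite -lamy /y scalerA divff ?gt_eqF // scale1r.
  split; first exact: ltW.
  - move=> i; rewrite inE => /eqP gi; rewrite bx gi mulr1; split=> //.
    by have [_] := K i; rewrite -/g gi mul1r => ->.
  - move=> i i0; rewrite bx normrM gtr0_norm // ger_pMr //.
    by rewrite inE in i0; split; [exact: (kkt_zero K) | exact: ltW].
  - move=> i; rewrite inE => /eqP gi; rewrite bx gi mulrN1; split=> //.
    by have [_] := K i; rewrite -/g gi mulN1r => h; rewrite -oppr_ge0 h.
have [B HB] := H _ _ _ J (ex_intro2 _ _ (lam, b, x) xG erefl).
move=> d dP Ad; apply/eqP; apply: contraT => d0.
pose N := 1 + l1norm d.
have N1 : 1 <= N by rewrite lerDl sumr_ge0.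
have N0 : 0 < N by lra.
pose d' := N^-1 *: d.
have d'1 i : `|d' i 0| <= 1.
  rewrite mxE normrM gtr0_norm ?invr_gt0 // ler_pdivrMl // mulr1.
  by rewrite /N /l1norm (bigD1 i) //= addrCA lerDl addr_ge0 // sumr_ge0.
pose b' := lam *: y + A *m s.
have Gz : coneG A Ip Iz Im (lam, b', s).
  rewrite -[s]addr0; apply: Gd => [|i _|i]; rewrite ?mxE ?normr0 //.
  by rewrite addr0 addrK.
have G1 : coneG A Ip Iz Im (lam, b', s + d').
  apply: Gd => // [|i /dP di]; last by rewrite mxE di mulr0.
  by rewrite mulmxDr -scalemxAr Ad scaler0 addr0 addrK.
have /= S' := HB (lam, b') (ex_intro2 _ _ _ Gz erefl).
have S0 : solS lam b' A s by apply/solSP => //; apply: coneG_kkt Gz; case: J.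
have S1 : solS lam b' A (s + d').
  by apply/solSP => //; apply: coneG_kkt G1; case: J.
move: S0 S1; rewrite S' /= => <- /eqP.
rewrite -subr_eq0 addrAC subrr add0r scaler_eq0 invr_eq0 gt_eqF //=.
by rewrite (negbTE d0).
Qed.

End Cones.

(** * Comparison of norms *)
Section Norms.
Variable R : realType.

Lemma entry_le_norm m n (A : 'M[R]_(m, n)) i j : `|A i j| <= `|A|.
Proof.
rewrite [leRHS]/Num.Def.normr /= mx_normrE.
by apply/bigmax_geP; right; exists (i, j).
Qed.

Lemma norm_le_entries m n (A : 'M[R]_(m, n)) c : 0 <= c ->
  (forall i j, `|A i j| <= c) -> `|A| <= c.
Proof.
move=> c0 Ac; rewrite [leLHS]/Num.Def.normr /= mx_normrE.
by apply/bigmax_leP; split=> // -[i j] _; exact: Ac.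
Qed.

Lemma norm_trmx m n (A : 'M[R]_(m, n)) : `|A^T| = `|A|.
Proof.
have le k l (B : 'M[R]_(k, l)) : `|B^T| <= `|B|.
  by apply: norm_le_entries => // i j; rewrite mxE entry_le_norm.
by apply/eqP; rewrite eq_le le -{1}[A]trmxK le.
Qed.

Lemma norm_mulmx m n p (A : 'M[R]_(m, n)) (B : 'M[R]_(n, p)) :
  `|A *m B| <= n%:R * `|A| * `|B|.
Proof.
apply: norm_le_entries => [|i j]; first by rewrite !mulr_ge0.
rewrite mxE (le_trans (ler_norm_sum _ _ _)) //.
rewrite -mulrA mulr_natl -[X in _ *+ X]card_ord -sumr_const ler_sum // => k _.
by rewrite normrM ler_pM // entry_le_norm.
Qed.

Lemma dotv_le n (u v : 'cV[R]_n) : `|dotv u v| <= n%:R * `|u| * `|v|.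
Proof.
rewrite -(norm_trmx u); apply: le_trans (norm_mulmx _ _).
exact: entry_le_norm.
Qed.

Lemma norm_le_enorm n (u : 'cV[R]_n) : `|u| <= enorm u.
Proof.
apply: norm_le_entries (enorm_ge0 _) _ => i j.
by rewrite (ord1 j) coord_le_enorm.
Qed.



Lemma enorm_le n (u : 'cV[R]_n) : enorm u <= n%:R * `|u|.
Proof.
have h : 0 <= n%:R * `|u| by rewrite mulr_ge0.
rewrite -(ger0_norm h) -sqrtr_sqr ler_sqrt ?sqr_ge0 //.
rewrite (le_trans (ler_norm _)) // (le_trans (dotv_le _ _)) //.
case: n u h => [|n] u h; first by rewrite !mul0r.
rewrite -mulrA -expr2 exprMn ler_wpM2r ?sqr_ge0 // expr2.
by rewrite ler_peMl // ler1n.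
Qed.

Lemma enormZ n a (u : 'cV[R]_n) : enorm (a *: u) = `|a| * enorm u.
Proof.
by rewrite /enorm !dotv_lin mulrA -expr2 sqrtrM ?sqr_ge0 // sqrtr_sqr.
Qed.

(** Turns a norm bound into the membership in a scaled ball by which Lipschitz
continuity is stated; c = 0 is allowed. *)
Lemma ball_scaled n (w : 'cV[R]_n) c : enorm w <= c ->
  exists2 v, unit_ball v & w = c *: v.
Proof.
move=> wc; have c0 := le_trans (enorm_ge0 w) wc.
have [c_eq0|c_neq0] := eqVneq c 0.
  exists 0; first by rewrite /unit_ball /= /enorm dotv0 sqrtr0.
  apply/eqP; rewrite scaler0 -dotv_eq0 -sqr_enorm expf_eq0 /= eq_le enorm_ge0.
  by rewrite andbT -c_eq0.
have cpos : 0 < c by rewrite lt0r c_neq0.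
exists (c^-1 *: w); last by rewrite scalerA divff // scale1r.
by rewrite /unit_ball /= enormZ gtr0_norm ?invr_gt0 // ler_pdivrMl // mulr1.
Qed.

Lemma unit_ball_coord n (v : 'cV[R]_n) i : unit_ball v -> `|v i 0| <= 1.
Proof. exact/le_trans/coord_le_enorm. Qed.

Lemma unit_ball_norm n (v : 'cV[R]_n) : unit_ball v -> `|v| <= 1.
Proof. exact/le_trans/norm_le_enorm. Qed.

Lemma specnorm_set0 m n (A : 'M[R]_(m, n)) :
  [set enorm (A *m v) | v in @unit_ball R n] 0.
Proof.
by exists 0; [rewrite /unit_ball /= /enorm dotv0 sqrtr0|
              rewrite mulmx0 /enorm dotv0 sqrtr0].
Qed.

Lemma enorm_mulmx_ball m n (A : 'M[R]_(m, n)) v : unit_ball v ->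
  enorm (A *m v) <= m%:R * (n%:R * `|A|).
Proof.
move=> v1; rewrite (le_trans (enorm_le _)) // ler_wpM2l //.
rewrite (le_trans (norm_mulmx _ _)) // ler_piMr ?mulr_ge0 //.
exact: unit_ball_norm.
Qed.

Lemma specnorm_has_sup m n (A : 'M[R]_(m, n)) :
  has_sup [set enorm (A *m v) | v in @unit_ball R n].
Proof.
split; first by exists 0; exact: specnorm_set0.
exists (m%:R * (n%:R * `|A|)) => _ [v v1 <-]; exact: enorm_mulmx_ball.
Qed.

Lemma specnorm_ge0 m n (A : 'M[R]_(m, n)) : 0 <= specnorm A.
Proof. exact: (ub_le_sup (specnorm_has_sup A).2) (specnorm_set0 A). Qed.

Lemma specnorm_le m n (A : 'M[R]_(m, n)) : specnorm A <= m%:R * (n%:R * `|A|).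
Proof.
apply: ge_sup (specnorm_has_sup A).1 _ => _ [v v1 <-].
exact: enorm_mulmx_ball.
Qed.

Lemma norm_le_specnorm m n (A : 'M[R]_(m, n)) : `|A| <= specnorm A.
Proof.
apply: norm_le_entries (specnorm_ge0 _) _ => i j.
have -> : A i j = (A *m delta_mx j 0 : 'cV[R]_m) i 0 by rewrite -colE mxE.
apply: (le_trans (coord_le_enorm _ _)).
apply: (ub_le_sup (specnorm_has_sup A).2); exists (delta_mx j 0) => //.
rewrite /unit_ball /= /enorm dotvE (bigD1 j) //= big1 ?addr0.
  by rewrite mxE !eqxx mulr1 sqrtr1.
by move=> k kj; rewrite mxE (negbTE kj) mul0r.
Qed.

Lemma norm_le_l1norm n (x : 'cV[R]_n) : `|x| <= l1norm x.
Proof.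
have l0 : 0 <= l1norm x by exact: sumr_ge0.
apply: norm_le_entries => // i j; rewrite (ord1 j).
by rewrite /l1norm (bigD1 i) //= lerDl sumr_ge0.
Qed.

End Norms.

(** * Local stability under independence of columns *)
Section Stability.
Variables (R : realType) (m n : nat).

Lemma near0_lt (k t : R) : 0 < t -> \forall e \near 0^'+, k * e < t.
Proof.
move=> t0; have k1 : 0 < `|k| + 1 by rewrite ltr_wpDl.
have : \forall e \near (0 : R)^'+, 0 < e /\ e < t / (`|k| + 1).
  near=> e; split; first by near: e; exact: nbhs_right_gt.
  by near: e; apply: nbhs_right_lt; rewrite divr_gt0.
apply: filterS => e [e0]; rewrite ltr_pdivlMr // => h.
apply: le_lt_trans h; rewrite mulrC ler_pM2l //.
by rewrite (le_trans (ler_norm _)) // lerDl.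
Unshelve. all: by end_near. Qed.

(** A distance of the data in the sup norms, in which all constants are
computed. *)
Definition data_gap (lam : R) (b : 'cV[R]_m) (A : 'M[R]_(m, n))
    (lam' : R) (b' : 'cV[R]_m) (A' : 'M[R]_(m, n)) : R :=
  `|lam - lam'| + `|b - b'| + `|A - A'|.

Lemma data_gap_ge0 lam b A lam' b' A' : 0 <= data_gap lam b A lam' b' A'.
Proof. by rewrite /data_gap !addr_ge0. Qed.

(** On bounded data with lam away from 0, cert is Lipschitz in the data; M bounds
all of them and x as well. *)
Lemma cert_lipschitz (c M : R) : 0 < c -> 0 <= M ->
  exists2 C, 0 <= C & forall lam b A lam' b' A' x,
  c <= lam -> c <= lam' -> `|b| <= M -> `|A| <= M -> `|A'| <= M -> `|x| <= M ->
  `|cert lam b A x - cert lam' b' A' x| <= C * data_gap lam b A lam' b' A'.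
Proof.
move=> c0 M0.
pose P := M + n%:R * M * M.
have P0 : 0 <= P by rewrite addr_ge0 // !mulr_ge0.
pose C1 := c^-1 * c^-1 * (m%:R * M * P).
pose C2 := c^-1 * (m%:R * M).
pose C3 := c^-1 * (m%:R * P + m%:R * M * (n%:R * M)).
have ci : 0 <= c^-1 by rewrite invr_ge0 ltW.
have C10 : 0 <= C1 by rewrite !mulr_ge0.
have C20 : 0 <= C2 by rewrite !mulr_ge0.
have C30 : 0 <= C3 by rewrite mulr_ge0 // addr_ge0 // !mulr_ge0.
exists (C1 + C2 + C3) => [|lam b A lam' b' A' x cl cl' bM AM A'M xM].
  by rewrite !addr_ge0.
have l0 : 0 < lam by exact: lt_le_trans cl.
have l0' : 0 < lam' by exact: lt_le_trans cl'.
have li : lam^-1 <= c^-1 by rewrite lef_pV2.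
have li' : lam'^-1 <= c^-1 by rewrite lef_pV2.
have i0 : 0 <= lam^-1 by rewrite invr_ge0 ltW.
have i0' : 0 <= lam'^-1 by rewrite invr_ge0 ltW.
have -> : cert lam b A x - cert lam' b' A' x =
    (lam^-1 - lam'^-1) *: (A^T *m (b - A *m x)) +
    (lam'^-1 *: (A'^T *m (b - b')) +
     lam'^-1 *: ((A - A')^T *m (b - A *m x) - A'^T *m ((A - A') *m x))).
  rewrite -scalerDr scalerBl -addrA; congr (_ + _).
  rewrite -!scalerN -scalerDr; congr (_ *: _).
  have -> : (A - A')^T = A^T - A'^T by rewrite linearB.
  rewrite !mulmxBl !mulmxBr.
  move: (A^T *m b) (A^T *m (A *m x)) (A'^T *m b) (A'^T *m b')
    (A'^T *m (A *m x)) (A'^T *m (A' *m x)) => u1 u2 u3 u4 u5 u6.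
  by apply/matrixP => i j; rewrite !mxE; ring.
have rP : `|b - A *m x| <= P.
  rewrite (le_trans (ler_normB _ _)) // lerD //.
  rewrite (le_trans (norm_mulmx _ _)) // ler_pM // ?mulr_ge0 //.
  by rewrite ler_wpM2l.
have T1 : `|(lam^-1 - lam'^-1) *: (A^T *m (b - A *m x))| <= C1 * `|lam - lam'|.
  rewrite normrZ.
  have -> : lam^-1 - lam'^-1 = lam^-1 * lam'^-1 * - (lam - lam').
    by field; rewrite !gt_eqF.
  rewrite !normrM normrN (ger0_norm i0) (ger0_norm i0') /C1 [leRHS]mulrAC.
  rewrite ler_pM // ?mulr_ge0 //.
    by rewrite ler_wpM2r // ler_pM.
  rewrite (le_trans (norm_mulmx _ _)) // norm_trmx ler_pM // ?mulr_ge0 //.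
  by rewrite ler_wpM2l.
have T2 : `|lam'^-1 *: (A'^T *m (b - b'))| <= C2 * `|b - b'|.
  rewrite normrZ ger0_norm // -mulrA ler_pM //.
  rewrite (le_trans (norm_mulmx _ _)) // norm_trmx ler_wpM2r //.
  by rewrite ler_wpM2l.
have T3 : `|lam'^-1 *: ((A - A')^T *m (b - A *m x) - A'^T *m ((A - A') *m x))|
    <= C3 * `|A - A'|.
  rewrite normrZ ger0_norm // -mulrA ler_pM //.
  rewrite (le_trans (ler_normB _ _)) // mulrDl lerD //.
    rewrite (le_trans (norm_mulmx _ _)) // norm_trmx mulrAC ler_wpM2r //.
    by rewrite ler_wpM2l.
  rewrite (le_trans (norm_mulmx _ _)) // norm_trmx -[leRHS]mulrA.
  rewrite ler_pM ?mulr_ge0 //; first by rewrite ler_wpM2l.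
  rewrite (le_trans (norm_mulmx _ _)) // mulrAC ler_wpM2r //.
  by rewrite ler_wpM2l.
rewrite (le_trans (ler_normD _ _)) //.
rewrite (le_trans (lerD (lexx _) (ler_normD _ _))) //.
rewrite (le_trans (lerD T1 (lerD T2 T3))) //.
set G := data_gap _ _ _ _ _ _.
have -> : (C1 + C2 + C3) * G = C1 * G + (C2 * G + C3 * G) by ring.
rewrite !lerD // ler_wpM2l // /G /data_gap.
- by rewrite -addrA lerDl addr_ge0.
- by rewrite addrAC lerDr addr_ge0.
- by rewrite lerDr addr_ge0.
Qed.

Lemma kkt_norm_le lam (b : 'cV[R]_m) (A : 'M[R]_(m, n)) x : 0 < lam ->
  kkt lam b A x -> `|x| <= lam^-1 * (m%:R * `|b| * `|b|).
Proof.
move=> lam0 K; rewrite (le_trans (norm_le_l1norm _)) //.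
rewrite (kkt_l1norm K) dotv_cert ler_wpM2l //; first by rewrite invr_ge0 ltW.
apply: (@le_trans _ _ (dotv b b)); last first.
  exact: le_trans (ler_norm _) (dotv_le b b).
have := dotv_ge0 (b - A *m x); have := dotv_ge0 b; have := dotv_ge0 (A *m x).
rewrite !dotv_lin (dotvC (A *m x) b); lra.
Qed.

(** Injectivity on a support is stable: d = L A^T (A d) bounds |d| by |A d|, and
the error of replacing A by a close A' is absorbed. *)
Lemma injective_lower_bound (A : 'M[R]_(m, n)) P : injective_on_support A P ->
  exists2 c, 0 < c & forall A', c * `|A' - A| <= 2^-1 ->
    forall d : 'cV[R]_n, (forall i, ~~ P i -> d i 0 = 0) ->
    `|d| <= c * `|A' *m d|.
Proof.
move=> /supported_solve [L [Ld _]].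
pose c0 := n%:R * `|L| * (m%:R * `|A|).
have c00 : 0 <= c0 by rewrite !mulr_ge0.
pose c := 2 * (c0 + 1) * (n%:R + 1).
have n0 : 0 <= (n%:R : R) by [].
have cpos : 0 < c by rewrite !mulr_gt0 // ltr_wpDl.
exists c => // A' A'A d dP.
have dA : `|d| <= c0 * `|A *m d|.
  rewrite {1}(Ld d dP) (le_trans (norm_mulmx _ _)) // -[leRHS]mulrA.
  rewrite ler_wpM2l ?mulr_ge0 //.
  by rewrite (le_trans (norm_mulmx _ _)) // norm_trmx.
have AA' : `|A *m d| <= `|A' *m d| + n%:R * `|A' - A| * `|d|.
  have -> : A *m d = A' *m d - (A' - A) *m d by rewrite mulmxBl subKr.
  by rewrite (le_trans (ler_normB _ _)) // lerD2l norm_mulmx.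
have h : c0 * n%:R * `|A' - A| <= 2^-1.
  apply: le_trans A'A; rewrite ler_wpM2r // /c; nra.
have h2 : `|d| <= c0 * `|A' *m d| + 2^-1 * `|d|.
  apply: (le_trans dA).
  apply: (le_trans (ler_wpM2l c00 AA')).
  rewrite mulrDr lerD2l !mulrA ler_wpM2r //.
have h3 : `|d| <= 2 * c0 * `|A' *m d| by lra.
apply: (le_trans h3); rewrite ler_wpM2r // /c; nra.
Qed.

(** First, solutions for nearby data are supported in P, because their certificate
stays strictly below 1 in absolute value off P; then the lower bound for A on
this support turns [fitted_distance] into a Lipschitz estimate. *)
Lemma condition12_local_stability lam (b : 'cV[R]_m) (A : 'M[R]_(m, n)) :
  0 < lam -> condition12 lam b A ->
  exists2 eta, 0 < eta & exists2 kappa, 0 <= kappa &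
    forall lam1 b1 A1, data_gap lam1 b1 A1 lam b A < eta ->
      0 < lam1 /\
      forall lam2 b2 A2 x1 x2, data_gap lam2 b2 A2 lam b A < eta ->
      kkt lam1 b1 A1 x1 -> kkt lam2 b2 A2 x2 ->
      `|x1 - x2| <= kappa * data_gap lam1 b1 A1 lam2 b2 A2.
Proof.
move=> lam0 /(condition12P _ _ lam0) [xb Kb inj].
set P := [pred i | _] in inj; pose gb := cert lam b A xb.
have [c1 c10 lower] := injective_lower_bound inj.
pose c := lam / 2; have c0 : 0 < c by rewrite divr_gt0.
pose X := c^-1 * (m%:R * (`|b| + 1) * (`|b| + 1)).
have ci : 0 <= c^-1 by rewrite invr_ge0 ltW.
have X0 : 0 <= X by rewrite /X !mulr_ge0 // addr_ge0.
pose M := `|b| + 1 + `|A| + 1 + X.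
have M0 : 0 <= M by rewrite /M !addr_ge0.
have [C C0 HC] := cert_lipschitz c0 M0.
pose c2 := lam * (n%:R * C * (2 * M)).
pose c3 := lam^-1 * (m%:R * `|A|).
have c30 : 0 <= c3 by rewrite !mulr_ge0 // invr_ge0 ltW.
(* A uniform margin of strict complementarity off P. *)
have : exists2 g, 0 < g & forall i, ~~ P i -> `|gb i 0| < 1 - g.
  suff /(@filter_ex _ _ _) [g [g0 Hg]] : \forall g \near (0 : R)^'+,
     0 < g /\ forall i, ~~ P i -> `|gb i 0| < 1 - g by exists g.
  near=> g; split; first by near: g; exact: nbhs_right_gt.
  near: g; apply: filter_forall => i; have [//|Pi] := boolP (P i).
    by move=> _; exact: filterE.
  have g1 : 0 < 1 - `|gb i 0|.
    by rewrite subr_gt0 lt_neqAle Pi; case: (Kb i).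
  by apply: filterS (nbhs_right_lt g1) => e h _; lra.
case=> g g0 Hg.
(* The fourth bound controls |A (xb - x1)|, whose square is of order e; the last
   one keeps the lower bound for the perturbed matrix valid. *)
have : exists2 e, 0 < e &
  [/\ e <= 1, e <= lam / 2, C * e < g / 2, c3 ^+ 2 * c2 * e < (g / 2) ^+ 2
    & c1 * e <= 2^-1].
  suff /(@filter_ex _ _ _) [e [e0 He]] : \forall e \near (0 : R)^'+, 0 < e /\
    [/\ e <= 1, e <= lam / 2, C * e < g / 2, c3 ^+ 2 * c2 * e < (g / 2) ^+ 2
      & c1 * e <= 2^-1] by exists e.
  near=> e; split; first by near: e; exact: nbhs_right_gt.
  split; near: e.
  - exact: nbhs_right_le.
  - exact: nbhs_right_le.
  - by apply: near0_lt; rewrite divr_gt0.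
  - by apply: near0_lt; rewrite exprn_gt0 // divr_gt0.
  - have h : 0 < 2^-1 :> R by rewrite invr_gt0.
    by apply: filterS (near0_lt c1 h) => e; exact: ltW.
case=> e e0 [e1 elam eC eg ec1].
pose near1 lam1 b1 A1 := data_gap lam1 b1 A1 lam b A < e.
have nearE lam1 b1 A1 : near1 lam1 b1 A1 ->
    [/\ c <= lam1, `|b1| <= M, `|A1| <= M, lam1 <= 2 * lam & `|A1 - A| <= e] /\
    `|b1| <= `|b| + 1.
  rewrite /near1 /data_gap => h.
  have hl := ler_norm (lam - lam1); rewrite distrC in hl.
  have hl2 := ler_norm (lam1 - lam).
  have hb := ler_normD b (b1 - b); rewrite [b + _]addrC subrK in hb.
  have hA := ler_normD A (A1 - A); rewrite [A + _]addrC subrK in hA.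
  have := normr_ge0 (lam1 - lam); have := normr_ge0 (b1 - b).
  have := normr_ge0 (A1 - A); have := normr_ge0 A; have := normr_ge0 b.
  rewrite /M /c; do !split; lra.
have bound lam1 b1 A1 x1 : near1 lam1 b1 A1 -> kkt lam1 b1 A1 x1 ->
    0 < lam1 /\ `|x1| <= M.
  move=> /nearE [[cl _ _ _ _] bb] K1; have l0 := lt_le_trans c0 cl.
  split=> //; apply: (le_trans (kkt_norm_le l0 K1)).
  have : lam1^-1 * (m%:R * `|b1| * `|b1|) <= X.
    have l0' := ltW l0; rewrite ler_pM ?mulr_ge0 ?invr_ge0 ?lef_pV2 //.
    by rewrite -!mulrA ler_wpM2l // ler_pM.
  have := normr_ge0 b; have := normr_ge0 A; rewrite /M; lra.
have near00 : near1 lam b A by rewrite /near1 /data_gap !subrr !normr0 !addr0.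
have [_ xbM] := bound _ _ _ _ near00 Kb.
have [[_ bM AM _ _] _] := nearE _ _ _ near00.
have supp lam1 b1 A1 x1 : near1 lam1 b1 A1 -> kkt lam1 b1 A1 x1 ->
    forall i, ~~ P i -> x1 i 0 = 0.
  move=> N1 K1 i Pi.
  have [l10 x1M] := bound _ _ _ _ N1 K1.
  have [[cl b1M A1M _ _] _] := nearE _ _ _ N1.
  have cl0 : c <= lam by rewrite /c; lra.
  have E1 : `|cert lam b A x1 - cert lam1 b1 A1 x1| <= C * e.
    apply: le_trans (HC _ _ _ _ _ _ _ cl0 cl bM AM A1M x1M) _.
    rewrite ler_wpM2l //; move: N1; rewrite /near1 /data_gap => /ltW.
    by rewrite (distrC lam1) (distrC b1) (distrC A1).
  pose f := A *m (xb - x1).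
  have f2 : dotv f f <= c2 * e.
    apply: (le_trans (fitted_distance lam0 Kb K1)).
    rewrite /c2 -mulrA ler_wpM2l //; first exact: ltW.
    rewrite (le_trans (ler_norm _)) //.
    rewrite (le_trans (dotv_le _ _)) //.
    have -> : n%:R * C * (2 * M) * e = n%:R * (C * e) * (2 * M) by ring.
    rewrite ler_pM // ?mulr_ge0 // ?ler_wpM2l //.
    by rewrite (le_trans (ler_normB _ _)) //; lra.
  have fn : c3 * `|f| < g / 2.
    rewrite ltNge; apply/negP => h.
    have g2 : 0 <= g / 2 by rewrite divr_ge0 // ltW.
    have h2 : (g / 2) ^+ 2 <= (c3 * `|f|) ^+ 2.
      by rewrite !expr2 ler_pM.
    have h3 : `|f| ^+ 2 <= dotv f f.
      by rewrite -sqr_enorm !expr2 ler_pM // norm_le_enorm.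
    have h4 : (c3 * `|f|) ^+ 2 <= c3 ^+ 2 * c2 * e.
      rewrite exprMn -mulrA ler_wpM2l ?sqr_ge0 //; exact: le_trans h3 f2.
    by have := le_lt_trans (le_trans h2 h4) eg; rewrite ltxx.
  have E2 : `|gb - cert lam b A x1| <= c3 * `|f|.
    have -> : gb - cert lam b A x1 = - (lam^-1 *: (A^T *m f)).
      by rewrite /gb (cert_increment _ _ _ _ x1) addrAC subrr add0r.
    rewrite normrN normrZ gtr0_norm ?invr_gt0 // /c3 -mulrA ler_wpM2l //.
      by rewrite invr_ge0 ltW.
    by rewrite (le_trans (norm_mulmx _ _)) // norm_trmx.
  have g1 : `|cert lam1 b1 A1 x1 i 0| < 1.
    have e1' := le_trans (entry_le_norm _ i 0) E1.
    have e2' := le_trans (entry_le_norm _ i 0) E2.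
    rewrite ![(_ - _ : 'cV[R]_n) i 0]mxE ![(- _ : 'cV[R]_n) i 0]mxE in e1' e2'.
    have := Hg i Pi; move: e1' e2' fn eC.
    move: (cert _ _ _ _ i 0) (cert _ _ _ _ i 0) (gb i 0) => u1 u2 u3.
    move=> h1 h2 h3 h4 h5.
    have -> : u2 = u3 - (u3 - u1) - (u1 - u2) by ring.
    have t1 := ler_normB (u3 - (u3 - u1)) (u1 - u2).
    have t2 := ler_normB u3 (u3 - u1).
    lra.
  exact: kkt_zero K1 g1.
pose kappa := c1 ^+ 2 * (2 * lam * (n%:R * C)).
exists e => //; exists kappa; first by rewrite !mulr_ge0 // ?sqr_ge0 // ltW.
move=> lam1 b1 A1 N1.
have [[cl1 b1M A1M ll1 A1e] _] := nearE _ _ _ N1.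
have l10 := lt_le_trans c0 cl1; split=> // lam2 b2 A2 x1 x2 N2 K1 K2.
have [[cl2 b2M A2M _ _] _] := nearE _ _ _ N2.
have [_ x2M] := bound _ _ _ _ N2 K2.
have dP i : ~~ P i -> (x1 - x2) i 0 = 0.
  move=> Pi; rewrite !mxE (supp _ _ _ _ N1 K1) // (supp _ _ _ _ N2 K2) //.
  exact: subrr.
have lo : `|x1 - x2| <= c1 * `|A1 *m (x1 - x2)|.
  apply: lower dP; apply: le_trans ec1; rewrite ler_wpM2l // ltW //.
have HE := HC lam1 b1 A1 lam2 b2 A2 x2 cl1 cl2 b1M A1M A2M x2M.
have up := fitted_distance l10 K1 K2.
set G := data_gap _ _ _ _ _ _ in HE *.
have G0 : 0 <= G := data_gap_ge0 _ _ _ _ _ _.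
set d := x1 - x2 in lo up *; set f := A1 *m d in lo up.
have f2 : `|f| ^+ 2 <= 2 * lam * (n%:R * (C * G) * `|d|).
  have h3 : `|f| ^+ 2 <= dotv f f.
    by rewrite -sqr_enorm !expr2 ler_pM // norm_le_enorm.
  apply: (le_trans h3); apply: (le_trans up).
  apply: (@le_trans _ _ (lam1 * (n%:R * (C * G) * `|d|))).
    rewrite ler_wpM2l //; first exact: ltW.
    rewrite (le_trans (ler_norm _)) //.
    by rewrite (le_trans (dotv_le _ _)) // ler_wpM2r // ler_wpM2l.
  by rewrite ler_wpM2r // !mulr_ge0.
have d2 : `|d| ^+ 2 <= kappa * G * `|d|.
  apply: (@le_trans _ _ ((c1 * `|f|) ^+ 2)).
    by rewrite !expr2 ler_pM.
  have -> : kappa * G * `|d| = c1 ^+ 2 * (2 * lam * (n%:R * (C * G) * `|d|)).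
    by rewrite /kappa; ring.
  by rewrite exprMn ler_wpM2l ?sqr_ge0.
have [->|d0] := eqVneq `|d| 0.
  by rewrite !mulr_ge0 // ?sqr_ge0 // ltW.
by rewrite expr2 ler_pM2r // lt0r d0 normr_ge0 in d2.
Unshelve. all: by end_near. Qed.

End Stability.

(** * Lipschitz continuity of the solution map *)
Section Lipschitz.
Variables (R : realType) (m n : nat).
Implicit Types (lam : R) (b : 'cV[R]_m) (A : 'M[R]_(m, n)).

Lemma data_gap_le_dist_data (z z' : R * 'cV[R]_m * 'M[R]_(m, n)) :
  data_gap z.1.1 z.1.2 z.2 z'.1.1 z'.1.2 z'.2 <= 3 * dist_data z z'.
Proof.
rewrite /data_gap /dist_data /dist_mx.
have h1 : 0 <= (z.1.1 - z'.1.1) ^+ 2 by exact: sqr_ge0.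
have h2 : 0 <= enorm (z.1.2 - z'.1.2) ^+ 2 by exact: sqr_ge0.
have h3 : 0 <= specnorm (z.2 - z'.2) ^+ 2 by exact: sqr_ge0.
have t1 : `|z.1.1 - z'.1.1| <= Num.sqrt ((z.1.1 - z'.1.1) ^+ 2 +
    enorm (z.1.2 - z'.1.2) ^+ 2 + specnorm (z.2 - z'.2) ^+ 2).
  rewrite -sqrtr_sqr ler_sqrt ?addr_ge0 //; lra.
have t2 : `|z.1.2 - z'.1.2| <= Num.sqrt ((z.1.1 - z'.1.1) ^+ 2 +
    enorm (z.1.2 - z'.1.2) ^+ 2 + specnorm (z.2 - z'.2) ^+ 2).
  rewrite (le_trans (norm_le_enorm _)) // -[leLHS]ger0_norm ?enorm_ge0 //.
  rewrite -sqrtr_sqr ler_sqrt ?addr_ge0 //; lra.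
have t3 : `|z.2 - z'.2| <= Num.sqrt ((z.1.1 - z'.1.1) ^+ 2 +
    enorm (z.1.2 - z'.1.2) ^+ 2 + specnorm (z.2 - z'.2) ^+ 2).
  rewrite (le_trans (norm_le_specnorm _)) // -[leLHS]ger0_norm ?specnorm_ge0 //.
  rewrite -sqrtr_sqr ler_sqrt ?addr_ge0 //; lra.
lra.
Qed.

Lemma nbhs_data_gap lam b A eta : 0 < eta ->
  nbhs (lam, b, A) [set z | data_gap z.1.1 z.1.2 z.2 lam b A < eta].
Proof.
move=> eta0; have e0 : 0 < eta / 3 by rewrite divr_gt0.
exists (ball lam (eta / 3) `*` ball b (eta / 3), ball A (eta / 3)).
  split; last exact: nbhsx_ballx.
  exists (ball lam (eta / 3), ball b (eta / 3)) => //.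
  by split; exact: nbhsx_ballx.
move=> [[l' b'] A'] [/= [/= hl hb] hA]; rewrite /data_gap /=.
rewrite -!ball_normE /= in hl hb hA.
rewrite distrC (distrC b') (distrC A'); lra.
Qed.

(** Uniqueness of nearby solutions is the case of equal data in the stability
estimate. *)
Lemma condition12_lipschitz lam b A : 0 < lam -> condition12 lam b A ->
  lipschitz_mf_around (@dist_data R m n)
    (fun z => solS z.1.1 z.1.2 z.2) (lam, b, A).
Proof.
move=> lam0 /(condition12_local_stability lam0)[eta eta0 [kappa k0 H]].
exists [set z | data_gap z.1.1 z.1.2 z.2 lam b A < eta].
  exact: nbhs_data_gap.
split=> [[[l1 b1] A1] /= N1|].
  have [l10 H1] := H _ _ _ N1; have [x K] := kkt_exists b1 A1 l10.
  split; first by exists x; apply/solSP.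
  have -> : solS l1 b1 A1 = [set x].
    apply/seteqP; split=> y /=; last by move=> ->; apply/solSP.
    move=> /(solSP _ _ _ l10) K'; have := H1 _ _ _ _ _ N1 K' K.
    rewrite /data_gap !subrr !normr0 !addr0 mulr0 normr_le0 subr_eq0 => /eqP //.
  exact/accessible_closed_set1/hausdorff_accessible/norm_hausdorff.
exists (n%:R * (kappa * 3)) => [|[[l1 b1] A1] [[l2 b2] A2] /= N1 N2 x2 S2].
  by rewrite !mulr_ge0.
have [l10 H1] := H _ _ _ N1; have [l20 H2] := H _ _ _ N2.
have [x1 K1] := kkt_exists b1 A1 l10.
have K2 : kkt l2 b2 A2 x2 by apply/solSP.
have [|v v1 E] := @ball_scaled R n (x2 - x1)
  (n%:R * (kappa * 3) * dist_data (l2, b2, A2) (l1, b1, A1)).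
  rewrite (le_trans (enorm_le _)) // -!mulrA ler_wpM2l //.
  rewrite (le_trans (H2 _ _ _ _ _ N1 K2 K1)) // ler_wpM2l //.
  exact: (data_gap_le_dist_data (l2, b2, A2) (l1, b1, A1)).
exists x1; first exact/solSP.
by exists v => //; rewrite -E addrC subrK.
Qed.

Lemma lipschitz_restrict lam b A :
  lipschitz_mf_around (@dist_data R m n)
    (fun z => solS z.1.1 z.1.2 z.2) (lam, b, A) ->
  lipschitz_mf_around (@dist_mx R m n) (fun A' => solS lam b A') A.
Proof.
move=> [X nX [Xc [kappa k0 H]]].
exists [set A' | X (lam, b, A')].
  case: nX => -[Q1 Q2] [/= /nbhs_singleton q1 q2] sub.
  by apply: filterS q2 => A' q; apply: sub.
split=> [A' XA'|]; first exact: (Xc (lam, b, A')).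
exists kappa => // A1 A2 X1 X2.
have := H (lam, b, A1) (lam, b, A2) X1 X2; rewrite /dist_data /=.
rewrite !subrr expr0n /= /enorm dotv0 sqrtr0 expr0n /= !add0r sqrtr_sqr.
by rewrite ger0_norm // specnorm_ge0.
Qed.

End Lipschitz.

(** * Discontinuity at a dependent support *)
Section Jump.
Variables (R : realType) (m n : nat).
Implicit Types (lam : R) (b : 'cV[R]_m) (A : 'M[R]_(m, n)).

(** The certificate g is orthogonal to d as A d = 0, so some g j * d j is negative
and moving along d decreases |x j|.  The first coordinate to vanish is the j
that minimizes the ratio |x j| / - (g j * d j); up to there no sign changes. *)
Lemma kkt_face_exit lam b A x (d : 'cV[R]_n) : kkt lam b A x ->
  A *m d = 0 -> d != 0 -> (forall i, x i 0 = 0 -> d i 0 = 0) ->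
  exists z j, [/\ kkt lam b A z, z j 0 = 0 & x j 0 != 0].
Proof.
move=> K Ad d0 dx; set g := cert lam b A x.
have gd0 : \sum_i g i 0 * d i 0 = 0.
  by rewrite -dotvE dotv_cert Ad dotv0 mulr0.
have [j0 j0P] : exists j, g j 0 * d j 0 < 0.
  apply: contrapT => /forallNP H; move/eqP: d0; apply.
  have gd_ge0 i : true -> 0 <= g i 0 * d i 0 by rewrite leNgt; move/negP: (H i).
  apply/colP => i; rewrite mxE.
  have /eqP := gd0; rewrite psumr_eq0 // => /allP /(_ i (mem_index_enum i)) /=.
  have [/dx -> //|xi] := eqVneq (x i 0) 0.
  rewrite mulf_eq0 -normr_eq0 /g (kkt_sign K xi) oner_eq0 => /eqP //.
pose F i := `|x i 0| / - (g i 0 * d i 0).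
have [j jP jmin] := @Order.TotalTheory.arg_minP _ _ _ j0
  [pred i | g i 0 * d i 0 < 0] F j0P.
have {}jP : g j 0 * d j 0 < 0 := jP.
pose t := F j.
have t0 : 0 <= t by rewrite /t /F mulr_ge0 // invr_ge0 oppr_ge0 ltW.
pose z := x + t *: d.
have Az : A *m z = A *m x by rewrite mulmxDr -scalemxAr Ad scaler0 addr0.
have gz : cert lam b A z = g by rewrite /g /cert Az.
have gzi i : g i 0 * z i 0 = `|x i 0| + t * (g i 0 * d i 0).
  by rewrite [z i 0]mxE [(t *: d) i 0]mxE mulrDr (K i).2 mulrCA.
have gz_ge0 i : 0 <= g i 0 * z i 0.
  rewrite gzi; have [gd|gd] := leP 0 (g i 0 * d i 0).
    by rewrite addr_ge0 // mulr_ge0.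
  have : t <= F i by apply: jmin.
  by rewrite /F ler_pdivlMr ?oppr_gt0 // mulrN -subr_ge0 opprK.
have xj : x j 0 != 0.
  by apply: contraTneq jP => /dx ->; rewrite mulr0 ltxx.
exists z, j; split=> //.
  move=> i; rewrite gz; split; first exact: (K i).1.
  have [xi|xi] := eqVneq (x i 0) 0.
    by rewrite !mxE xi (dx _ xi) mulr0 addr0 mulr0 normr0.
  have := ger0_norm (gz_ge0 i).
  by rewrite normrM /g (kkt_sign K xi) mul1r => ->.
have : g j 0 * z j 0 == 0.
  rewrite gzi /t /F; move: (g j 0 * d j 0) jP => a a0.
  have an0 : a != 0 by rewrite lt_eqF.
  by rewrite invrN mulrN mulNr divfK // subrr.
by rewrite mulf_eq0 -normr_eq0 /g (kkt_sign K xj) oner_eq0 => /eqP.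
Qed.

(** The matrix here is A with column j multiplied by 1 - t.  Since z j = 0, the
fit of z and so its residual are unchanged and z stays optimal, now with a
certificate strictly below 1 in absolute value at j; all solutions share it. *)
Lemma shrunk_column_kkt lam b A z j t : 0 < lam -> 0 < t <= 1 ->
  kkt lam b A z -> z j 0 = 0 ->
  forall w, kkt lam b (A - t *: (A *m delta_mx j j)) w -> w j 0 = 0.
Proof.
move=> lam0 /andP[t0 t1] K zj; set A' := A - _.
have dz : delta_mx j j *m z = 0 :> 'cV[R]_n.
  apply/colP => i; rewrite !mxE big1 // => k _; rewrite !mxE.
  by have [->|_] := eqVneq k j; rewrite ?zj ?mulr0 // andbF mul0r.
have Az : A' *m z = A *m z.
  by rewrite mulmxBl -scalemxAl -mulmxA dz mulmx0 scaler0 subr0.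
have gE i : cert lam b A' z i 0 = (1 - t * (i == j)%:R) * cert lam b A z i 0.
  rewrite /cert Az; set r := b - _.
  have -> : A'^T *m r = A^T *m r - t *: (delta_mx j j *m (A^T *m r)).
    have -> : A'^T = A^T - t *: (delta_mx j j *m A^T).
      by apply/matrixP => p k; rewrite -[delta_mx j j]trmx_delta -trmx_mul !mxE.
    by rewrite mulmxBl -scalemxAl mulmxA.
  move: (A^T *m r) => w.
  rewrite !mxE (bigD1 j) //= big1 => [|k kj]; last first.
    by rewrite !mxE (negbTE kj) andbF mul0r.
  rewrite !mxE eqxx andbT addr0.
  by have [->|_] := eqVneq i j; rewrite ?eqxx /= ?mulr1n ?mulr0n; ring.
have K' : kkt lam b A' z.
  move=> i; rewrite gE; have [gi gz] := K i.
  have [->|_] := eqVneq i j; last by rewrite mulr0 subr0 mul1r.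
  rewrite mulr1 zj mulr0 normr0 normrM; split=> //.
  rewrite mulr_ile1 //; last exact: (K j).1.
  by rewrite ger0_norm; lra.
move=> w Kw; apply: (kkt_zero Kw).
rewrite /cert (fitted_unique lam0 Kw K') -/(cert _ _ _ _) gE eqxx mulr1 normrM.
have g1 := (K j).1; rewrite ger0_norm; last by lra.
have := normr_ge0 (cert lam b A z j 0); clear -t0 t1 g1; nra.
Qed.

(** Solutions for the shrunk matrices keep the distance |x j| > 0 from x, although
these matrices converge to A. *)
Lemma not_lipschitz_at_face lam b A x (d : 'cV[R]_n) : 0 < lam ->
  kkt lam b A x -> A *m d = 0 -> d != 0 ->
  (forall i, x i 0 = 0 -> d i 0 = 0) ->
  ~ lipschitz_mf_around (@dist_mx R m n) (fun A' => solS lam b A') A.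
Proof.
move=> lam0 K Ad d0 dx [X nX [Xne [kappa k0 H]]].
have [z [j [Kz zj xj]]] := kkt_face_exit K Ad d0 dx.
pose B := A *m delta_mx j j.
have AtA : A - t *: B @[t --> (0 : R)^'+] --> A.
  rewrite -[X in _ --> X]subr0 -(scale0r B).
  apply: cvgB; first exact: cvg_cst.
  apply: cvgZr_tmp; exact/cvg_at_right_filter/cvg_id.
have xj0 : 0 < `|x j 0| by rewrite normr_gt0.
have nearX : \forall t \near (0 : R)^'+, X (A - t *: B) by exact: AtA.
suff /(@filter_ex _ _ _)[t [[t0 t1] Xt small]] : \forall t \near (0 : R)^'+,
    [/\ 0 < t /\ t <= 1, X (A - t *: B)
      & kappa * (m%:R * (n%:R * `|B|)) * t < `|x j 0|].
  have Sx : solS lam b A x by apply/solSP.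
  have [w Sw [v v1 E]] := H _ _ Xt (nbhs_singleton nX) x Sx.
  have wj : w j 0 = 0.
    have t01 : 0 < t <= 1 by rewrite t0 t1.
    by apply: (shrunk_column_kkt lam0 t01 Kz zj); apply/solSP.
  move: small; rewrite ltNge => /negP; apply.
  rewrite -E !mxE wj add0r normrM.
  rewrite [`|_ * dist_mx _ _|]ger0_norm ?mulr_ge0 ?specnorm_ge0 //.
  rewrite -[leRHS]mulr1 ler_pM ?mulr_ge0 ?specnorm_ge0 ?unit_ball_coord //.
  rewrite -[leRHS]mulrA ler_wpM2l // (le_trans (specnorm_le _)) //.
  rewrite opprB addrC subrK.
  by rewrite normrZ gtr0_norm // -!mulrA (mulrC t).
near=> t; split; [split | |]; near: t.
- exact: nbhs_right_gt.
- exact: nbhs_right_le.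
- exact: nearX.
- exact: near0_lt.
Unshelve. all: by end_near. Qed.

End Jump.

(** * Nearby matrices with a fully supported solution *)
Section Tilt.
Variables (R : realType) (m n : nat).
Implicit Types (lam : R) (b : 'cV[R]_m) (A : 'M[R]_(m, n)).

(** The rank-one correction q w^T adds w i * |q|^2 to the correlation of column i
with q.  These weights make it equal to lam * g i * sg for i in P, hence to
lam * g i after the division by sg in [tilt]. *)
Definition tilt_weights lam A (P : pred 'I_n) (g : 'cV[R]_n) (q : 'cV[R]_m) sg
    : 'cV[R]_n :=
  (dotv q q)^-1 *:
  \col_i (if P i then lam * g i 0 * sg - (A^T *m q) i 0 else 0).

Definition tilt lam A (P : pred 'I_n) (g : 'cV[R]_n) (q : 'cV[R]_m) sg :
    'M[R]_(m, n) :=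
  sg^-1 *: (A + q *m (tilt_weights lam A P g q sg)^T).

Lemma outer_mulmx (q : 'cV[R]_m) (w v : 'cV[R]_n) :
  q *m w^T *m v = dotv w v *: q.
Proof. by rewrite -mulmxA [w^T *m v]mx11_scalar mul_mx_scalar. Qed.

(** Under this hypothesis v is orthogonal to the weights, so that the correction
does not act on v. *)
Lemma tilt_mulmx lam A P g q sg (v : 'cV[R]_n) :
  (forall i, ~~ P i -> v i 0 = 0) ->
  lam * dotv g v * sg = dotv (A *m v) q ->
  tilt lam A P g q sg *m v = sg^-1 *: (A *m v).
Proof.
move=> vP E; rewrite -scalemxAl mulmxDl outer_mulmx.
suff -> : dotv (tilt_weights lam A P g q sg) v = 0 by rewrite scale0r addr0.
rewrite dotvZl [dotv (\col_i _) v](_ : _ = 0) ?mulr0 //.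
have -> : dotv (\col_i (if P i then lam * g i 0 * sg - (A^T *m q) i 0 else 0)) v
    = lam * dotv g v * sg - dotv (A^T *m q) v.
  rewrite !dotvE mulr_sumr mulr_suml -sumrB; apply: eq_bigr => i _.
  rewrite mxE; have [_|/vP ->] := boolP (P i); last first.
    by rewrite !mulr0 mul0r subrr.
  by ring.
by rewrite E dotv_trl dotvC subrr.
Qed.

(** The scalar sg is imposed by the last hypothesis, which says that the
correction does not act on u: the tilted matrix then has at sg * u the same
fit as A at u, hence the residual q to which the weights are adapted. *)
Lemma tilt_kkt lam b A (P : pred 'I_n) (g u : 'cV[R]_n) sg :
  let q := b - A *m u in
  0 < lam -> 0 < sg -> q != 0 ->
  (forall i, P i -> `|g i 0| = 1 /\ g i 0 * u i 0 = `|u i 0|) ->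
  (forall i, ~~ P i -> u i 0 = 0 /\ `|(A^T *m q) i 0| <= lam * sg) ->
  lam * l1norm u * sg = dotv (A *m u) q ->
  kkt lam b (tilt lam A P g q sg) (sg *: u).
Proof.
move=> q lam0 sg0 q0 gP uP E.
have qq : dotv q q != 0 by rewrite dotv_eq0.
have gu : dotv g u = l1norm u.
  rewrite dotvE; apply: eq_bigr => i _.
  by have [/gP[]//|/uP[-> _]] := boolP (P i); rewrite mulr0 normr0.
have Au : tilt lam A P g q sg *m (sg *: u) = A *m u.
  rewrite -scalemxAr tilt_mulmx ?scalerA ?divff ?gt_eqF ?scale1r //.
    by move=> i /uP[].
  by rewrite gu.
have certE i : cert lam b (tilt lam A P g q sg) (sg *: u) i 0 =
    if P i then g i 0 else (lam * sg)^-1 * (A^T *m q) i 0.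
  rewrite /cert Au -/q.
  have -> : (tilt lam A P g q sg)^T *m q =
    sg^-1 *: (A^T *m q + dotv q q *: tilt_weights lam A P g q sg).
    have -> : (tilt lam A P g q sg)^T =
        sg^-1 *: (A^T + tilt_weights lam A P g q sg *m q^T).
      by rewrite /tilt linearZ /= linearD /= trmx_mul trmxK.
    rewrite -scalemxAl mulmxDl -mulmxA.
    by rewrite [q^T *m q]mx11_scalar mul_mx_scalar.
  rewrite /tilt_weights [dotv q q *: _]scalerA divff // scale1r.
  move: (A^T *m q) => w; rewrite !mxE.
  by case: (P i); field; rewrite !gt_eqF.
move=> i; rewrite certE [(sg *: u) i 0]mxE.
have [/gP[g1 gui]|/uP[-> le1]] := boolP (P i).
  by rewrite g1 mulrCA gui normrM (gtr0_norm sg0).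
rewrite !mulr0 normr0; split=> //.
rewrite normrM gtr0_norm ?invr_gt0 ?mulr_gt0 //.
by rewrite ler_pdivrMl ?mulr_gt0 // mulr1.
Qed.

Lemma dotv_l1_le (u w : 'cV[R]_n) : `|dotv u w| <= l1norm u * `|w|.
Proof.
rewrite dotvE (le_trans (ler_norm_sum _ _ _)) // /l1norm mulr_suml.
by apply: ler_sum => i _; rewrite normrM ler_wpM2l // entry_le_norm.
Qed.

(** Take u = x + e s with s the sign vector of P, and the tilt determined by u.
As e tends to 0+ the residual q tends to b - A x, the scalar sg to 1 and the
weights to 0, so that the tilted matrices tend to A.  The vector d stays in the
kernel, being orthogonal to the certificate g. *)
Lemma dependent_equicorrelation_tilt lam b A x (d : 'cV[R]_n)
    (X : set 'M[R]_(m, n)) :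
  0 < lam -> kkt lam b A x -> A *m d = 0 -> d != 0 ->
  (forall i, `|cert lam b A x i 0| != 1 -> d i 0 = 0) -> nbhs A X ->
  exists A' x', [/\ nbhs A' X, kkt lam b A' x', A' *m d = 0
    & forall i, x' i 0 = 0 -> d i 0 = 0].
Proof.
move=> lam0 K Ad d0 dP nX.
set g := cert lam b A x; pose P : pred 'I_n := [pred i | `|g i 0| == 1].
pose s : 'cV[R]_n := \col_i (if P i then g i 0 else 0).
pose r := b - A *m x.
have gr : lam *: g = A^T *m r by rewrite scalerA divff ?gt_eqF // scale1r.
have gri i : (A^T *m r) i 0 = lam * g i 0 by rewrite -gr [LHS]mxE.
have [k dk] : exists k, d k 0 != 0.
  apply: contrapT => /forallNP H; move/eqP: d0; apply; apply/colP => i.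
  by rewrite mxE; have /negP := H i; rewrite negbK => /eqP.
have Pk : P k by apply: contraNT dk => /dP ->.
have r0 : r != 0.
  apply/eqP => r0; move: Pk; rewrite /P /= /g /cert -/r r0 mulmx0 scaler0.
  by rewrite mxE normr0 eq_sym oner_eq0.
have gd : dotv g d = 0 by rewrite dotv_cert Ad dotv0 mulr0.
pose u e := x + e *: s; pose q e := b - A *m u e.
pose sg e := dotv (A *m u e) (q e) / (lam * l1norm (u e)).
have uP e i : ~~ P i -> u e i 0 = 0.
  move=> Pi; rewrite [u e i 0]mxE [(e *: s) i 0]mxE [s i 0]mxE (negbTE Pi).
  rewrite mulr0 addr0; apply: (kkt_zero K).
  by rewrite lt_neqAle Pi; case: (K i).
have guP e i : 0 < e -> P i -> g i 0 * u e i 0 = `|u e i 0| /\ u e i 0 != 0.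
  move=> e0 Pi; have gg : g i 0 * g i 0 = 1.
    by rewrite -expr2 -real_normK ?num_real // (eqP Pi) expr1n.
  have gu : g i 0 * u e i 0 = `|x i 0| + e.
    rewrite [u e i 0]mxE [(e *: s) i 0]mxE [s i 0]mxE Pi mulrDr (K i).2.
    by rewrite mulrCA gg mulr1.
  have gu0 : 0 < g i 0 * u e i 0 by rewrite gu ltr_wpDl.
  split.
    by rewrite -[LHS]gtr0_norm // normrM (eqP Pi) mul1r.
  by apply: contraTneq gu0 => ->; rewrite mulr0 ltxx.
have gu e : 0 < e -> dotv g (u e) = l1norm (u e).
  move=> e0; rewrite dotvE; apply: eq_bigr => i _.
  have [/(guP e i e0)[]//|/uP->] := boolP (P i); by rewrite mulr0 normr0.
have l1u e : 0 < e -> 0 < l1norm (u e).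
  move=> e0; rewrite /l1norm (bigD1 k) //= ltr_pwDl ?sumr_ge0 // normr_gt0.
  by case: (guP e k e0 Pk).
have qE e : q e = r - e *: (A *m s).
  by rewrite /q /u mulmxDr -scalemxAr opprD addrA.
have Auq e : 0 < e ->
    dotv (A *m u e) (q e) =
    lam * l1norm (u e) - e * dotv (u e) (A^T *m (A *m s)).
  move=> e0; rewrite qE dotvDr dotvNr dotvZr; congr (_ - _ * _).
    by rewrite dotvC -dotv_trl -gr dotvZl gu.
  by rewrite dotvC -dotv_trl dotvC.
(* For x = 0 both the numerator and the denominator of sg vanish at e = 0, so the
   limit comes from an estimate relative to the l1 norm of u. *)
have sg1 : sg e @[e --> (0 : R)^'+] --> (1 : R).
  apply/cvgrPdist_lt => c c0.
  have := near0_lt (lam^-1 * `|A^T *m (A *m s)|) c0.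
  have := nbhs_right_gt (0 : R).
  apply: filterS2 => e e0 h; apply: le_lt_trans h.
  have l0 := l1u e e0.
  have -> : 1 - sg e = e * dotv (u e) (A^T *m (A *m s)) / (lam * l1norm (u e)).
    by rewrite /sg Auq //; field; rewrite !gt_eqF.
  have lu0 : 0 < lam * l1norm (u e) by rewrite mulr_gt0.
  rewrite normrM [X in _ * X]gtr0_norm ?invr_gt0 // ler_pdivrMr //.
  rewrite normrM gtr0_norm // [leRHS](_ : _ =
    e * (l1norm (u e) * `|A^T *m (A *m s)|)); last by field; rewrite gt_eqF.
  by rewrite ler_wpM2l ?dotv_l1_le // ltW.
have qr : q e @[e --> (0 : R)^'+] --> r.
  rewrite (_ : q = fun e => r - e *: (A *m s)); last exact/funext.
  rewrite -[X in _ --> X]subr0 -(scale0r (A *m s)).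
  apply: cvgB; first exact: cvg_cst.
  by apply: cvgZr_tmp; exact/cvg_at_right_filter/cvg_id.
have rr : dotv r r != 0 by rewrite dotv_eq0.
have Aq : A^T *m q e @[e --> (0 : R)^'+] --> A^T *m r.
  by apply: cvg_mulmx; first exact: cvg_cst.
have tw0 : tilt_weights lam A P g (q e) (sg e) @[e --> (0 : R)^'+] -->
    (0 : 'cV[R]_n).
  have -> : (0 : 'cV[R]_n) = (dotv r r)^-1 *: 0 by rewrite scaler0.
  rewrite /tilt_weights; apply: cvgZ.
    by apply: cvgV => //; exact: cvg_dotv.
  apply/cvg_mxP => i j; rewrite mxE; under eq_cvg do rewrite mxE.
  have [Pi|_] := boolP (P i); last exact: cvg_cst.
  suff : lam * g i 0 * sg e - (A^T *m q e) i 0 @[e --> (0 : R)^'+] -->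
      lam * g i 0 * 1 - (A^T *m r) i 0 by rewrite gri mulr1 subrr.
  apply: cvgB; last by move/cvg_mxP: Aq.
  by apply: cvgM; first exact: cvg_cst.
have tA : tilt lam A P g (q e) (sg e) @[e --> (0 : R)^'+] --> A.
  suff : tilt lam A P g (q e) (sg e) @[e --> (0 : R)^'+] -->
      1^-1 *: (A + r *m (0 : 'cV[R]_n)^T).
    by rewrite trmx0 mulmx0 addr0 invr1 scale1r.
  rewrite /tilt; apply: cvgZ; first by apply: cvgV sg1; exact: oner_neq0.
  apply: cvgD; first exact: cvg_cst.
  by apply: cvg_mulmx => //; exact: cvg_trmx.
suff /(@filter_ex _ _ _)[e [e0 sg0 q0 slack Xe]] : \forall e \near (0 : R)^'+,
    [/\ 0 < e, 0 < sg e, q e != 0,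
        forall i, ~~ P i -> `|(A^T *m q e) i 0| <= lam * sg e
      & nbhs (tilt lam A P g (q e) (sg e)) X].
  exists (tilt lam A P g (q e) (sg e)), (sg e *: u e); split=> //.
  - apply: tilt_kkt => // [i Pi|i Pi|].
    + by split; [exact/eqP | case: (guP e i e0 Pi)].
    + by split; [exact: uP | exact: slack].
    + by rewrite /sg mulrC divfK // mulf_neq0 // gt_eqF // l1u.
  - rewrite tilt_mulmx ?Ad ?scaler0 //.
    by rewrite gd mulr0 mul0r dot0v.
  - move=> i; rewrite mxE => /eqP; rewrite mulf_eq0 gt_eqF //= => /eqP ui.
    have [Pi|/dP //] := boolP (P i).
    by have [_] := guP e i e0 Pi; rewrite ui eqxx.
near=> e; split; near: e.
- exact: nbhs_right_gt.
- exact: cvgr_gt sg1 _ ltr01.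
- have : dotv r r > 0 by rewrite dotv_gt0.
  move=> /(cvgr_gt _ (cvg_dotv _ qr qr)); apply: filterS => e.
  by rewrite dotv_gt0.
- apply: filter_forall => i; have [_|Pi] := boolP (P i).
    exact: filterE.
  have lim : lam * sg e - `|(A^T *m q e) i 0| @[e --> (0 : R)^'+] -->
      lam * 1 - `|(A^T *m r) i 0|.
    apply: cvgB; first by apply: cvgM; first exact: cvg_cst.
    by apply: cvg_norm; move/cvg_mxP: Aq.
  have pos : 0 < lam * 1 - `|(A^T *m r) i 0|.
    rewrite gri normrM gtr0_norm // -mulrBr mulr_gt0 //.
    by rewrite subr_gt0 lt_neqAle Pi; case: (K i).
  by apply: filterS (cvgr_gt _ lim _ pos) => e; rewrite subr_gt0 => /ltW.
- exact: (tA _ (nbhs_interior nX)).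
Unshelve. all: by end_near. Qed.

Lemma lipschitz_condition12 lam b A : 0 < lam ->
  lipschitz_mf_around (@dist_mx R m n) (fun A' => solS lam b A') A ->
  condition12 lam b A.
Proof.
move=> lam0 [X nX H]; apply/condition12P => //.
have [x K] := kkt_exists b A lam0; exists x => //.
apply: contrapT => /not_injective_on_support [d [dP Ad d0]].
have [A' [x' [nX' K' Ad' dx']]] :=
  dependent_equicorrelation_tilt lam0 K Ad d0 dP nX.
by apply: (not_lipschitz_at_face lam0 K' Ad' d0 dx'); exists X.
Qed.

End Tilt.


Unset Implicit Arguments.

(** * The equivalence *)

Theorem proposition4p1 (R : realType) (m n : nat)
    (lam : R) (b : 'cV[R]_m) (A : 'M[R]_(m, n)) (lam_gt0 : 0 < lam) :
  [<-> condition12 lam b A;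
       lipschitz_mf_around (@dist_data R m n)
         (fun z => solS z.1.1 z.1.2 z.2) (lam, b, A);
       lipschitz_mf_around (@dist_mx R m n) (fun A' => solS lam b A') A;
       forall Ip I0 Im : {set 'I_n}, setJ A Ip I0 Im ->
         P12 (coneG A Ip I0 Im) (lam, b) ->
         single_valued_linear_on (fun z => solS z.1 z.2 A)
           (P12 (coneG A Ip I0 Im))].
Proof.
tfae.
- exact: condition12_lipschitz.
- exact: lipschitz_restrict.
- by move=> /(lipschitz_condition12 lam_gt0); exact: condition12_linear.
- exact: linear_condition12.
Qed.
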